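(* For all $f,h\in\mathcal S(\mathbb R^d)$, the following dynamic equations hold: $$\mathrm E_{\mathcal A}\,\varphi(f)^2=\sigma_f-\mathrm E_{\mathcal A}\,\varphi(f)\,\partial_{\tilde f}\mathcal A,$$ $$\mathrm E_{\mathcal A}\,\varphi(f)\varphi(h)=(\tilde f,h)-\mathrm E_{\mathcal A}\,\varphi(f)\,\partial_{\tilde h}\mathcal A;$$ for the higher order moments, $$\mathrm E_{\mathcal A}\,\varphi(f)^p=(p-1)\,\sigma_f\,\mathrm E_{\mathcal A}\,\varphi(f)^{p-2}-\mathrm E_{\mathcal A}\,\varphi(f)^{p-1}\,\partial_{\tilde f}\mathcal A;$$ and, for the second moment, $$\mathrm E_{\mathcal A}\,\varphi(f)^2=\sigma_f+\mathrm E_{\mathcal A}\big((\partial_{\tilde f}\mathcal A)^2-\partial_{\tilde f}^2\mathcal A\big).$$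
   Context: $\mu_0$ is the centered Gaussian probability measure on $\mathcal S'(\mathbb R^d)$ with covariance operator $C=(-\Delta+1)^{-1}$, and $\mathrm E$ is expectation under $\mu_0$. For an action functional $\mathcal A:\mathcal S'(\mathbb R^d)\to\mathbb R$, the interacting measure is $d\mu_{\mathcal A}=Z_{\mathcal A}^{-1}e^{-\mathcal A}d\mu_0$ with $Z_{\mathcal A}=\mathrm E\,e^{-\mathcal A}$, and $\mathrm E_{\mathcal A}$ is expectation under $\mu_{\mathcal A}$. For a functional $Y$ on $\mathcal S'(\mathbb R^d)$ and $h\in\mathcal S(\mathbb R^d)$, $\partial_hY(\varphi)=\lim_{\varepsilon\to0}\frac1\varepsilon\big(Y(\varphi+\varepsilon h)-Y(\varphi)\big)$ when this limit exists, and $\partial_h^2Y=\partial_h(\partial_hY)$. The functional $\mathcal A$ is assumed such that the derivatives and expectations appearing exist (as for the regularized $\varphi^4$ action). Here $(\cdot,\cdot)$ is the $L^2(\mathbb R^d)$ inner product, $\tilde f=Cf$, $\tilde h=Ch$, and $\sigma_f=(f,\tilde f)=(f,Cf)$. *)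

(* Defs.v *)
From HB Require Import structures.
From mathcomp Require Import all_boot all_order all_algebra.
From mathcomp Require Import all_classical all_reals all_analysis.
From mathcomp Require Import measurable_realfun.

Set Implicit Arguments.
Unset Strict Implicit.
Unset Printing Implicit Defensive.

Import Order.TTheory GRing.Theory Num.Theory.
Import numFieldNormedType.Exports.

Local Open Scope classical_set_scope.
Local Open Scope ring_scope.

Section schwartz_predicate.
Context {R : realType} {d : nat}.
Implicit Types (f g : 'rV[R]_d -> R^o) (s : seq 'I_d).

Definition partial (i : 'I_d) f : 'rV[R]_d -> R^o := 'D_('e_i) f.

(* A multi-index is given as the list of the directions of differentiation. *)
Definition partials s f : 'rV[R]_d -> R^o := foldr partial f s.

(* The norm of ['rV_d] is the sup norm, equivalent to the Euclidean one. *)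
Definition is_schwartz f : Prop :=
  (forall s x, differentiable (partials s f) x) /\
  (forall k s, exists M : R, forall x, `|x| ^+ k * `|partials s f x| <= M).

Lemma partials_lin s (a : R) f g :
  (forall s x, differentiable (partials s f) x) ->
  (forall s x, differentiable (partials s g) x) ->
  partials s (a *: f + g) = a *: partials s f + partials s g.
Proof.
move=> df dg; elim: s => [//|i s IH] /=; rewrite IH.
apply/funext => x; rewrite /partial deriveD ?deriveZ //.
- exact: diff_derivable.
- by apply: derivableZ; exact: diff_derivable.
- exact: diff_derivable.
Qed.

Lemma partials0 s : partials s 0 = 0.
Proof.
elim: s => [//|i s IH] /=; rewrite IH; apply/funext => x.
by rewrite /partial derive_cst.
Qed.

Definition schwartz_pred : {pred 'rV[R]_d -> R^o} := fun f => `[< is_schwartz f >].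

Lemma schwartz_submod : submod_closed schwartz_pred.
Proof.
split=> [|a f g /asboolP[df bf] /asboolP[dg bg]]; apply/asboolP; split.
- by move=> s x; rewrite partials0; exact: differentiable_cst.
- move=> k s; exists 0 => x; rewrite partials0.
  by rewrite (_ : (0 : 'rV[R]_d -> R^o) x = 0)// normr0 mulr0.
- move=> s x; rewrite partials_lin//.
  by apply: differentiableD => //; exact: differentiableZ.
- move=> k s; have [M HM] := bf k s; have [N HN] := bg k s.
  exists (`|a| * M + N) => x; rewrite partials_lin//.
  apply: (@le_trans _ _ (`|x| ^+ k * (`|a| * `|partials s f x| + `|partials s g x|))).
    rewrite ler_wpM2l ?exprn_ge0//; apply: le_trans (ler_normD _ _) _.
    by rewrite normrZ.
  rewrite mulrDr mulrCA lerD// ler_wpM2l//; exact: HM.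
Qed.

HB.instance Definition _ :=
  GRing.isSubmodClosed.Build R ('rV[R]_d -> R^o) schwartz_pred schwartz_submod.

End schwartz_predicate.

Section schwartz_type.
Variables (R : realType) (d : nat).

Record schwartz := Schwartz {
  schwartz_fun :> 'rV[R]_d -> R^o ;
  schwartz_funP : schwartz_fun \in schwartz_pred }.

HB.instance Definition _ := [isSub for schwartz_fun].
HB.instance Definition _ := [Choice of schwartz by <:].
HB.instance Definition _ := [SubChoice_isSubLmodule of schwartz by <:].

End schwartz_type.

Section schwartz_topology.
Context {R : realType} {d : nat}.
Local Notation S := (schwartz R d).
Implicit Types (f g h : S) (s : seq 'I_d) (k : nat).

Lemma schwartzP f : is_schwartz f.
Proof. exact/asboolP/(schwartz_funP f). Qed.

Lemma schwartz_linE (a : R) f g x : (a *: f + g) x = a * f x + g x.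
Proof. by []. Qed.

Definition seminorm k s f : R :=
  sup [set `|x| ^+ k * `|partials s f x| | x in [set: 'rV[R]_d]].

Lemma seminorm_ub k s f x : `|x| ^+ k * `|partials s f x| <= seminorm k s f.
Proof.
apply: ub_le_sup; last by exists x.
have [M HM] := (schwartzP f).2 k s.
by exists M => _ [y _ <-].
Qed.

Lemma seminorm_le k s f M :
  (forall x, `|x| ^+ k * `|partials s f x| <= M) -> seminorm k s f <= M.
Proof.
move=> HM; apply: ge_sup; last by move=> _ [y _ <-].
by exists (`|0 : 'rV[R]_d| ^+ k * `|partials s f 0|), 0.
Qed.

Lemma seminormD k s f g : seminorm k s (f + g) <= seminorm k s f + seminorm k s g.
Proof.
apply: seminorm_le => x; rewrite -[f]scale1r.
rewrite (_ : schwartz_fun (1 *: f + g) =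
  (1 : R) *: schwartz_fun f + schwartz_fun g)//.
rewrite partials_lin; [|exact: (schwartzP f).1|exact: (schwartzP g).1].
rewrite !scale1r.
apply: le_trans (lerD (seminorm_ub k s f x) (seminorm_ub k s g x)).
by rewrite -mulrDr ler_wpM2l ?exprn_ge0// ler_normD.
Qed.

Lemma seminorm0 k s : seminorm k s 0 <= 0.
Proof.
apply: seminorm_le => x; rewrite partials0.
by rewrite (_ : (0 : 'rV[R]_d -> R^o) x = 0)// normr0 mulr0.
Qed.

Definition seminorm_ball f (N : nat) (e : R) : set S :=
  [set g | forall k s, (k <= N)%N -> (size s <= N)%N -> seminorm k s (g - f) < e].

(* The locally convex topology defined by the family of all the seminorms. *)
Definition schwartz_nbhs f : set_system S :=
  [set A | exists N e, 0 < e /\ seminorm_ball f N e `<=` A].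

HB.instance Definition _ := hasNbhs.Build S schwartz_nbhs.

Lemma seminorm_ball_center f N (e : R) : 0 < e -> seminorm_ball f N e f.
Proof. by move=> e0 k s _ _; rewrite subrr (le_lt_trans (seminorm0 k s)). Qed.

Let nbhs_pf f : ProperFilter (nbhs f).
Proof.
split.
  by move=> [N [e [e0]]] /(_ f); apply; exact: seminorm_ball_center.
split.
- by exists 0%N, 1; split.
- move=> A B [N [e [e0 eA]]] [M [r [r0 rB]]].
  exists (maxn N M), (Num.min e r); split; first by rewrite lt_min e0.
  move=> g Hg; split.
    by apply: eA => k s kN sN; have := Hg k s; rewrite lt_min !leq_max kN sN => /(_ isT isT)/andP[].
  by apply: rB => k s kN sN; have := Hg k s; rewrite lt_min !leq_max kN sN !orbT => /(_ isT isT)/andP[].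
- by move=> A B AB [N [e [e0 eA]]]; exists N, e; split => //; exact: subset_trans AB.
Qed.

Let nbhs_sing f (A : set S) : nbhs f A -> A f.
Proof. by move=> [N [e [e0]]]; apply; exact: seminorm_ball_center. Qed.

Let nbhs_nb f (A : set S) : nbhs f A -> nbhs f (nbhs^~ A).
Proof.
move=> [N [e [e0 eA]]]; exists N, (e / 2); split; first by rewrite divr_gt0.
move=> g Hg; exists N, (e / 2); split; first by rewrite divr_gt0.
move=> h Hh; apply: eA => k s kN sN.
rewrite -(subrK g h) -addrA (splitr e).
by apply: le_lt_trans (seminormD _ _ _ _) _; rewrite ltrD ?Hh ?Hg.
Qed.

HB.instance Definition _ :=
  Nbhs_isNbhsTopological.Build S nbhs_pf nbhs_sing nbhs_nb.

End schwartz_topology.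

Section resolvent.
Context {R : realType} {d : nat}.
Local Notation S := (schwartz R d).
Implicit Types f u : S.

Lemma partial_schwartz (i : 'I_d) f : partial i f \in schwartz_pred.
Proof.
apply/asboolP; have [df bf] := schwartzP f.
have E s : partials s (partial i f) = partials (rcons s i) f.
  by rewrite /partials foldr_rcons.
by split=> [s x|k s]; rewrite E.
Qed.

Definition spartial (i : 'I_d) f : S := Schwartz (partial_schwartz i f).

Definition laplacian f : S := \sum_(i < d) spartial i (spartial i f).

(* [-Δ + 1] is a bijection of the Schwartz space (it is multiplication by
   [1 + |ξ|^2] on the Fourier side), so that its inverse can be defined by
   choosing a preimage. *)
Definition resolvent f : S := xget 0 [set u | - laplacian u + u = f].

End resolvent.

Section lebesgue_tuple.
Context {R : realType}.
Local Notation RT n := (n.-tuple (measurableTypeR R)).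

Section cons_measure.
Variables (n : nat) (mu : {sigma_finite_measure set (RT n) -> \bar R}).

Definition tcons (x : measurableTypeR R * RT n) : RT n.+1 := [tuple of x.1 :: x.2].
Definition tuncons (t : RT n.+1) : measurableTypeR R * RT n :=
  (thead t, [tuple of behead t]).

Lemma tconsK : cancel tuncons tcons.
Proof. by move=> t; rewrite /tcons/= [RHS]tuple_eta; apply: val_inj. Qed.

Lemma tunconsK : cancel tcons tuncons.
Proof. by move=> [x t]; rewrite /tuncons /tcons theadE; congr pair; apply: val_inj. Qed.

Lemma measurable_tcons : measurable_fun setT tcons.
Proof. exact: measurable_cons. Qed.

Lemma measurable_tuncons : measurable_fun setT tuncons.
Proof.
apply/measurable_fun_pairP; split; last exact: measurable_behead.
exact: measurable_tnth.
Qed.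

Definition cons_measure : set (RT n.+1) -> \bar R :=
  pushforward (lebesgue_measure \x mu)%E tcons.

Let cons_measure0 : cons_measure set0 = 0%E.
Proof. by rewrite /cons_measure /pushforward preimage_set0 measure0. Qed.

Let cons_measure_ge0 A : (0 <= cons_measure A)%E.
Proof. by rewrite /cons_measure /pushforward; exact: measure_ge0. Qed.

Let cons_measure_sigma_additive : semi_sigma_additive cons_measure.
Proof.
by apply: (@measure_semi_sigma_additive _ _ _
  (measure_function_pushforward__canonical__measure_function_Measure
    _ measurable_tcons)).
Qed.

HB.instance Definition _ := isMeasure.Build _ _ _ cons_measure
  cons_measure0 cons_measure_ge0 cons_measure_sigma_additive.

Lemma cons_measure_sigma_finite : sigma_finite setT cons_measure.
Proof.
have /sigma_finiteP[F [TF ndF Foo]] := sigma_finiteT (@lebesgue_measure R).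
have /sigma_finiteP[G [TG ndG Goo]] := sigma_finiteT mu.
exists (fun k => tuncons @^-1` (F k `*` G k)).
  apply/esym/seteqP; split=> // t _.
  have : (\bigcup_k F k) (tuncons t).1 by rewrite -TF.
  move=> [m _ Fm]; have : (\bigcup_k G k) (tuncons t).2 by rewrite -TG.
  move=> [k _ Gk]; exists (maxn m k) => //; split.
  - by move: Fm; exact/subsetPset/ndF/leq_maxl.
  - by move: Gk; exact/subsetPset/ndG/leq_maxr.
move=> k; have [mF Fk] := Foo k; have [mG Gk] := Goo k; split.
  rewrite -[X in measurable X]setTI; apply: measurable_tuncons => //.
  exact: measurableX.
rewrite /cons_measure /pushforward -comp_preimage.
rewrite (_ : tuncons \o tcons = id); last by apply/funext => x; exact: tunconsK.
by rewrite preimage_id product_measure1E// lte_mul_pinfty// ge0_fin_numE.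
Qed.

HB.instance Definition _ :=
  Measure_isSigmaFinite.Build _ _ _ cons_measure cons_measure_sigma_finite.

End cons_measure.

Fixpoint lebesgue_tuple n : {sigma_finite_measure set (RT n) -> \bar R} :=
  match n with
  | 0 => (\d_([tuple] : RT 0))
  | m.+1 => cons_measure (lebesgue_tuple m)
  end.

End lebesgue_tuple.

Section inner_product.
Context {R : realType} {d : nat}.
Local Notation S := (schwartz R d).
Local Notation RT := (d.-tuple (measurableTypeR R)).

Definition vec (t : RT) : 'rV[R]_d := \row_i tnth t i.

Definition inner (f g : S) : R :=
  (\int[lebesgue_tuple d]_t (f (vec t) * g (vec t)))%R.

Let grid k (t : RT) : {ffun 'I_d -> int} :=
  [ffun i => Num.floor ((tnth t i : R) * k.+1%:R)].

Let node k (z : {ffun 'I_d -> int}) : 'rV[R]_d := \row_i ((z i)%:~R / k.+1%:R).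

Let measurable_grid k z : measurable [set t : RT | grid k t = z].
Proof.
rewrite (_ : mkset _ = \bigcap_(i in [set: 'I_d])
    ((fun t : RT => tnth t i) @^-1`
      [set` `[(z i)%:~R / k.+1%:R : R, (z i + 1)%:~R / k.+1%:R[%R])).
  apply: (@fin_bigcap_measurable _ RT) => [|i _]; first exact: finite_finset.
  rewrite -[X in measurable X]setTI; exact: measurable_tnth.
apply/seteqP; split=> t /=.
  move=> <- i _ /=; rewrite in_itv /= ffunE.
  by rewrite ler_pdivrMr// ltr_pdivlMr// floor_itv.
move=> H; apply/ffunP => i; rewrite ffunE.
have := H i I; rewrite /= in_itv /= ler_pdivrMr// ltr_pdivlMr// => Hi.
exact: floor_def.
Qed.

Let cvg_node (t : RT) : node k (grid k t) @[k --> \oo] --> vec t.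
Proof.
apply/cvgrPdist_le => e e0; near=> k.
apply: (@le_trans _ _ k.+1%:R^-1); last first.
  by apply: ltW; near: k; exact: (near_infty_natSinv_lt (PosNum e0)).
rewrite [leLHS]mx_normrE; apply/bigmax_leP; split; first by rewrite invr_ge0.
move=> [i j] _ /=; rewrite !mxE ffunE.
have /andP[h1 h2] := floor_itv ((tnth t j : R) * k.+1%:R).
rewrite ger0_norm; last by rewrite subr_ge0 ler_pdivrMr.
rewrite lerBlDr -[X in _ <= X + _]mul1r -mulrDl ler_pdivlMr// addrC.
by move: h2; rewrite intrD => /ltW.
Unshelve. all: by end_near. Qed.

Lemma measurable_vec (f : 'rV[R]_d -> R) : continuous f ->
  measurable_fun setT (f \o vec).
Proof.
move=> cf.
apply: (@measurable_fun_cvg _ _ _ _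
   (fun k t => f (node k (grid k t)))); last first.
  move=> t _; apply: (@cvg_comp _ _ _ (fun k => node k (grid k t)) f); first exact: cvg_node.
  exact: cf.
move=> k _ B mB; rewrite setTI.
rewrite (_ : _ @^-1` _ = \bigcup_z ([set t | grid k t = z] `&` [set _ | B (f (node k z))])).
  apply: countable_bigcupT_measurable => // z.
  apply: measurableI; first exact: measurable_grid.
  have [Bz|nBz] := pselect (B (f (node k z))).
    by rewrite (_ : mkset _ = setT)//; apply/seteqP; split.
  by rewrite (_ : mkset _ = set0)//; apply/seteqP; split.
apply/seteqP; split=> t /=; first by exists (grid k t).
by move=> [z _ [<-]].
Qed.

End inner_product.

Section integrability.
Context {R : realType}.
Local Notation RT n := (n.-tuple (measurableTypeR R)).

Let weight n (t : RT n) : R := \prod_(i < n) (oneDsqr (tnth t i : R))^-1.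

Let measurable_weight n : measurable_fun setT (@weight n).
Proof.
apply: measurable_prod => i _.
apply: (@measurableT_comp _ _ _ _ _ _ (fun x : R => (oneDsqr x)^-1) _
  (fun t : RT n => tnth t i)); last exact: measurable_tnth.
apply: continuous_measurable_fun; exact: continuous_oneDsqrV.
Qed.

Let weight_ge0 n t : 0 <= @weight n t.
Proof. by apply: prodr_ge0 => i _; rewrite invr_ge0 (le_trans ler01)// oneDsqr_ge1. Qed.

Let integral_oneDsqr : (\int[lebesgue_measure]_x ((oneDsqr (x : R))^-1)%:E = pi%:E)%E.
Proof.
rewrite ge0_symfun_integralT.
- rewrite (_ : [set x | _] = `[0%R, +oo[%classic); last first.
    by apply/seteqP; split => x /=; rewrite in_itv/= andbT.
  by rewrite integral0y_oneDsqr -EFinM mulrC divfK.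
- by move=> x; rewrite invr_ge0 (le_trans ler01)// oneDsqr_ge1.
- exact: continuous_oneDsqrV.
- by move=> x /=; rewrite /oneDsqr sqrrN.
Qed.

Let weight_fin n : (\int[lebesgue_tuple n]_t (@weight n t)%:E < +oo)%E.
Proof.
elim: n => [|n IH].
  rewrite integral_dirac//=; first by rewrite diracT mul1e ltry.
  by apply/measurable_EFinP; exact: measurable_weight.
rewrite ge0_integral_pushforward//=; last 3 first.
- exact: measurable_tcons.
- by apply/measurable_EFinP; exact: measurable_weight.
- by move=> t _; rewrite lee_fin.
rewrite preimage_setT.
under eq_integral => x _.
  rewrite /= (_ : weight (tcons x) = (oneDsqr (x.1 : R))^-1 * weight x.2); last first.
    by rewrite /weight big_ord_recl; congr (_ * _); apply: eq_bigr => i _; rewrite tnthS.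
  over.
rewrite (fubini_tonelli1 (fun x : measurableTypeR R * RT n => ((oneDsqr (x.1 : R))^-1 * weight x.2)%:E))//=.
- rewrite /fubini_F /=.
  under eq_integral => x _.
    under eq_integral => y _ do rewrite EFinM.
    rewrite ge0_integralZl//; last 2 first.
    + by apply/measurable_EFinP; exact: measurable_weight.
    + by move=> y _; rewrite lee_fin.
    over.
  rewrite ge0_integralZr//.
  + by rewrite integral_oneDsqr lte_mul_pinfty// lee_fin pi_ge0.
  + apply/measurable_EFinP.
    apply: continuous_measurable_fun; exact: continuous_oneDsqrV.
  + by apply: integral_ge0 => y _; rewrite lee_fin.
- apply/measurable_EFinP; apply: measurable_funM.
    apply: (@measurableT_comp _ _ _ _ _ _ (fun x : R => (oneDsqr x)^-1)) => //.
    apply: continuous_measurable_fun; exact: continuous_oneDsqrV.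
  by apply: measurableT_comp => //; exact: measurable_weight.
- move=> x; rewrite lee_fin mulr_ge0// invr_ge0 (le_trans ler01)// oneDsqr_ge1.
Qed.

Variable d : nat.
Local Notation S := (schwartz R d).

Lemma schwartz_continuous (f : S) : continuous (f : 'rV[R]_d -> R).
Proof. by move=> x; apply: differentiable_continuous; exact: ((schwartzP f).1 [::]). Qed.

Lemma integrable_schwartz (f : S) :
  (lebesgue_tuple d).-integrable setT (EFin \o (f \o vec)).
Proof.
pose M := 2 ^+ d * (seminorm 0 [::] f + seminorm (2 * d) [::] f).
have MP t : `|f (vec t)| <= M * weight t.
  rewrite /weight prodfV ler_pdivlMr; last first.
    by apply: prodr_gt0 => i _; rewrite (lt_le_trans ltr01)// oneDsqr_ge1.
  set a := `|vec t|; have a0 : 0 <= a := normr_ge0 _.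
  have h1 : \prod_(i < d) oneDsqr (tnth t i : R) <= (1 + a ^+ 2) ^+ d.
    rewrite -[d in _ ^+ d]card_ord -prodr_const; apply: ler_prod => i _.
    rewrite (le_trans ler01) ?oneDsqr_ge1//= /oneDsqr lerD2l.
    rewrite -[leLHS]real_normK ?num_real// lerXn2r ?nnegrE ?normr_ge0//.
    rewrite /a [leRHS]mx_normrE.
    have := le_bigmax 0 (fun ij : 'I_1 * 'I_d => `|vec t ij.1 ij.2|) (ord0, i).
    by rewrite /= mxE.
  have h2 : (1 + a ^+ 2) ^+ d <= 2 ^+ d * (1 + a ^+ (2 * d)).
    have [a1|a1] := leP (a ^+ 2) 1.
      apply: (@le_trans _ _ (2 ^+ d)).
        by rewrite lerXn2r ?nnegrE ?addr_ge0 ?sqr_ge0// -[2]/(1 + 1) lerD2l.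
      by rewrite ler_peMr ?exprn_ge0// lerDl exprn_ge0.
    apply: (@le_trans _ _ ((2 * a ^+ 2) ^+ d)).
      rewrite lerXn2r ?nnegrE ?addr_ge0 ?mulr_ge0 ?sqr_ge0//.
      by rewrite [leRHS]mulr_natl mulr2n lerD2r ltW.
    by rewrite exprMn -exprM ler_wpM2l ?exprn_ge0// lerDr.
  apply: le_trans (ler_wpM2l (normr_ge0 _) (le_trans h1 h2)) _.
  rewrite mulrCA ler_wpM2l ?exprn_ge0// mulrDr mulr1 lerD//.
    by have := seminorm_ub 0 [::] f (vec t); rewrite expr0 mul1r.
  by rewrite mulrC; exact: (seminorm_ub (2 * d) [::] f (vec t)).
apply: (@le_integrable _ _ _ _ _ _ _ (fun t => (M * weight t)%:E)) => //.
- apply/measurable_EFinP.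
  exact: measurable_vec (schwartz_continuous (f := f)).
- move=> t _ /=; rewrite lee_fin (le_trans (MP t))//.
  exact: ler_norm.
under eq_fun do rewrite EFinM.
apply: integrableZl => //; apply/integrableP; split.
  by apply/measurable_EFinP; exact: measurable_weight.
under eq_integral do rewrite gee0_abs ?lee_fin//.
exact: weight_fin.
Qed.

Lemma integrable_inner (f g : S) :
  (lebesgue_tuple d).-integrable setT (EFin \o (fun t => f (vec t) * g (vec t))).
Proof.
rewrite (_ : EFin \o _ = ((EFin \o (f \o vec)) \* (EFin \o (g \o vec)))%E)//.
apply: integrableMr => //; last exact: integrable_schwartz.
  exact: measurable_vec (schwartz_continuous (f := f)).
exists (seminorm 0 [::] f); split; first exact: num_real.
move=> x fx t _; rewrite /= (le_trans _ (ltW fx))//.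
by have := seminorm_ub 0 [::] f (vec t); rewrite expr0 mul1r.
Qed.

Lemma innerC (f g : S) : inner f g = inner g f.
Proof. by rewrite /inner; under eq_Rintegral do rewrite mulrC. Qed.

Lemma inner_linear (f : S) : linear (inner f : S -> R^o).
Proof.
move=> a g h; rewrite /inner.
under eq_Rintegral => t _ do rewrite schwartz_linE mulrDr mulrCA.
rewrite RintegralD//; first by rewrite RintegralZl//; exact: integrable_inner.
- exact: (integrableZl _ a (integrable_inner f g)).
- exact: integrable_inner.
Qed.

Lemma inner_continuous (f : S) : continuous (inner f : S -> R^o).
Proof.
pose K := (\int[lebesgue_tuple d]_t `|f (vec t)|)%R.
have K0 : 0 <= K by apply: Rintegral_ge0.
have bnd g : `|inner f g| <= K * seminorm 0 [::] g.
  apply: le_trans (le_normr_Rintegral _ (integrable_inner f g)) _ => //.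
  rewrite mulrC -RintegralZl//; last first.
    exact: (integrable_norm (integrable_schwartz f)).
  apply: le_Rintegral => //.
  - exact: (integrable_norm (integrable_inner f g)).
  - apply: (integrableZl _ _ (integrable_norm (integrable_schwartz f))) => //.
  - move=> t _; rewrite normrM mulrC ler_wpM2r//.
    by have := seminorm_ub 0 [::] g (vec t); rewrite expr0 mul1r.
move=> g; apply/(@cvgrPdist_lt _ _ _ _ (@nbhs_filter S g)) => e e0.
exists 0%N, (e / (K + 1)); split; first by rewrite divr_gt0// ltr_wpDl.
move=> h Hh /=.
have -> : inner f g - inner f h = - inner f (h - g).
  by rewrite [h - g]addrC -[- g]scaleN1r inner_linear scaleN1r opprD opprK.
rewrite normrN; apply: le_lt_trans (bnd _) _.
have := Hh 0%N [::] (leqnn _) (leqnn _).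
rewrite ltr_pdivlMr ?ltr_wpDl//; apply: le_lt_trans.
rewrite mulrDr mulr1 mulrC lerDl.
by apply: le_trans (seminorm_ub 0 [::] _ 0); rewrite mulr_ge0.
Qed.

End integrability.

Section tempered_predicate.
Context {R : realType} {d : nat}.
Local Notation S := (schwartz R d).

Definition is_tempered (u : S -> R^o) : Prop := linear u /\ continuous u.

Definition tempered_pred : {pred S -> R^o} := fun u => `[< is_tempered u >].

Lemma tempered_submod : submod_closed tempered_pred.
Proof.
split=> [|a u v /asboolP[lu cu] /asboolP[lv cv]]; apply/asboolP; split.
- by move=> b f g; rewrite [in LHS]/0 /= scaler0 addr0.
- exact: cst_continuous.
- move=> b f g; rewrite /= !fctE lu lv; rewrite !scalerDr !scalerA (mulrC a b).
  by rewrite addrACA.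
- by move=> f; apply: continuousD; [|exact: cv];
  apply: continuousZ; [exact: cst_continuous|exact: cu].
Qed.

HB.instance Definition _ :=
  GRing.isSubmodClosed.Build R (S -> R^o) tempered_pred tempered_submod.

End tempered_predicate.

Section tempered_type.
Variables (R : realType) (d : nat).

Record tempered := Tempered {
  tempered_fun :> schwartz R d -> R^o ;
  tempered_funP : tempered_fun \in tempered_pred }.

HB.instance Definition _ := [isSub for tempered_fun].
HB.instance Definition _ := [Choice of tempered by <:].
HB.instance Definition _ := [SubChoice_isSubLmodule of tempered by <:].
HB.instance Definition _ := isPointed.Build tempered 0.

(* The cylinder sigma-algebra, generated by the evaluations [phi |-> phi f];
   it is also the Borel sigma-algebra of the strong and weak-* topologies. *)
Definition cylinders : set_system tempered :=
  [set (fun phi : tempered => phi f) @^-1` B |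
     f in [set: schwartz R d] & B in (@measurable _ (measurableTypeR R))].

HB.instance Definition _ := @isMeasurable.Build (sigma_display cylinders)
  tempered <<s cylinders >> (@sigma_algebra0 _ setT cylinders)
  (@sigma_algebraC _ cylinders) (@sigma_algebra_bigcup _ setT cylinders).

End tempered_type.

Section tempered_theory.
Context {R : realType} {d : nat}.
Local Notation S := (schwartz R d).
Local Notation S' := (tempered R d).

Definition ev (f : S) : S' -> measurableTypeR R := fun phi => phi f.

Lemma measurable_ev (f : S) : measurable_fun setT (ev f).
Proof.
by move=> _ B mB; rewrite setTI; apply: sub_sigma_algebra; exists f => //; exists B.
Qed.

HB.instance Definition _ (f : S) :=
  isMeasurableFun.Build _ _ _ _ (ev f) (measurable_ev f).

Lemma inner_tempered (h : S) : (inner h : S -> R^o) \in tempered_pred.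
Proof. by apply/asboolP; split; [exact: inner_linear|exact: inner_continuous]. Qed.

(* The regular distribution [psi |-> (h, psi)] attached to a test function. *)
Definition embed (h : S) : S' := Tempered (inner_tempered h).

Section directional_derivative.
Variables (h : S) (Y : S' -> R) (phi : S').

Definition diff_quotient (e : R) : R^o := e^-1 * (Y (phi + e *: embed h) - Y phi).

Definition dderivable : Prop := cvg (diff_quotient e @[e --> 0^']).

Definition dderive : R := lim (diff_quotient e @[e --> 0^']).

End directional_derivative.

(* [normal_prob m 0] is not the Dirac mass at [m], whence the case analysis. *)
Definition gaussian_law (nu : set (measurableTypeR R) -> \bar R) : Prop :=
  exists m s : R, forall U, measurable U ->
    nu U = if s == 0 then \d_m U else normal_prob m s U.

Record centered_gaussian (mu : probability S' R) (C : S -> S) : Prop := {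
  gaussian_ev : forall f : S, gaussian_law (distribution mu (ev f)) ;
  centered_ev : forall f : S, ('E_mu[ev f] = 0)%E ;
  covariance_ev : forall f g : S,
    covariance mu (ev f) (ev g) = (inner f (C g))%:E }.

Section gibbs.
Variables (mu : probability S' R) (A : {mfun S' >-> measurableTypeR R}).

Definition boltzmann (U : set S') : \bar R :=
  (\int[mu]_(phi in U) (expR (- (A phi : R)))%:E)%E.

Let measurable_density D :
  measurable_fun D (fun phi => (expR (- (A phi : R)))%:E).
Proof.
apply/measurable_EFinP; apply: measurableT_comp => //.
by apply: measurableT_comp => //; apply: measurable_funTS.
Qed.

Let boltzmann0 : boltzmann set0 = 0%E.
Proof. by rewrite /boltzmann integral_set0. Qed.

Let boltzmann_ge0 U : (0 <= boltzmann U)%E.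
Proof. by apply: integral_ge0 => phi _; rewrite lee_fin expR_ge0. Qed.

Let boltzmann_sigma_additive : semi_sigma_additive boltzmann.
Proof.
move=> F mF tF mUF; rewrite /boltzmann.
have f0 phi : (\bigcup_k F k) phi -> (0 <= (expR (- (A phi : R)))%:E)%E.
  by move=> _; rewrite lee_fin expR_ge0.
rewrite (ge0_integral_bigcup mu mF (@measurable_density _) f0 tF).
apply: is_cvg_ereal_nneg_natsum_cond => n _ _.
by apply: integral_ge0 => phi _; rewrite lee_fin expR_ge0.
Qed.

HB.instance Definition _ := isMeasure.Build _ _ _ boltzmann
  boltzmann0 boltzmann_ge0 boltzmann_sigma_additive.

(* The measure [Z^-1 e^-A dmu]. The second argument of [mnormalize] is a
   default value, only used if [Z = 0] or [Z = +oo]. *)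
Definition gibbs : probability S' R := mnormalize boltzmann mu.

End gibbs.

End tempered_theory.

(* Main.v *)
From HB Require Import structures.
Require Import Defs.
From mathcomp Require Import all_boot all_order all_algebra.
From mathcomp Require Import all_classical all_reals all_analysis.
From mathcomp Require Import measurable_realfun ring lra.

(* The covariance identity says that [embed (C h)], the regular distribution
   attached to [C h], pairs with [g] to [cov (phi g, phi h)]. Hence, if [v] is
   the variance of [phi h], replacing [phi] by [phi + ((x - phi h) / v) k] with
   [k := embed (C h)] changes the coordinate [phi h] to [x] and keeps the part
   of [phi] that is uncorrelated with [phi h]. Characteristic functions show
   that [mu0] is invariant when [x] is an independent normal variable of
   variance [v]; no property of the resolvent is used. Integrating along the
   lines of direction [k] reduces the Gaussian integration by parts
     [E (phi h * F) = E (d_k F)]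
   to the one-dimensional identity of Stein. As [F] is only assumed to be
   differentiable along [k], without continuity of the derivative, the
   latter rests on the fundamental theorem of calculus for everywhere
   differentiable functions with an integrable derivative. The four equations
   are the cases [F = Y e^-A] for [Y] a power of [phi f] or [Y = d_k A]. *)

Set Implicit Arguments.
Unset Strict Implicit.
Unset Printing Implicit Defensive.

Import Order.TTheory GRing.Theory Num.Theory.
Import numFieldNormedType.Exports.

Local Open Scope classical_set_scope.
Local Open Scope ring_scope.

(** * Integrals of everywhere defined derivatives *)

(** Continuous induction. Let [c] be the supremum of the [t] in [[a, b]] with [P a t]. The local
    hypothesis at [c] links a point of this set just below [c] to a point beyond [c], which is
    impossible unless [c = b]. *)
Lemma cousin_segment (R : realType) (P : R -> R -> Prop) (a b : R) : a <= b ->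
  (forall x y z, x <= y -> y <= z -> P x y -> P y z -> P x z) ->
  (forall x, a <= x <= b -> exists2 e, 0 < e &
    forall s t, a <= s -> s <= x <= t -> t <= b -> t - s < e -> P s t) ->
  P a b.
Proof.
move=> ab Ptrans Ploc.
pose S := [set t | a <= t <= b /\ P a t].
have Sa : S a.
  have [|e e0 Pe] := Ploc a; first by rewrite lexx.
  by split; [rewrite lexx ab | apply: Pe; rewrite ?lexx ?subrr].
have Sub : has_ubound S by exists b => t [/andP[]].
have Ssup : has_sup S by split=> //; exists a.
set c := sup S.
have ac : a <= c by exact: ub_le_sup.
have cb : c <= b by apply: ge_sup; [exists a | move=> t [/andP[]]].
have [|e e0 Pe] := Ploc c; first by rewrite ac.
have [s [/andP[as_ sb] Pas] cs] := sup_adherent (divr_gt0 e0 (ltr0n R 2)) Ssup.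
rewrite -/c in cs.
have sc : s <= c by apply: ub_le_sup => //; split=> //; rewrite as_ sb.
(* As [s] lies within [e / 2] of [c], the length [t - s] stays below [e]; and [t] exceeds [c] unless
   [b <= c]. *)
pose t := Num.min b (c + e / 4).
have ct : c <= t by rewrite le_min cb lerDl divr_ge0 ?ltW.
have tb : t <= b by rewrite ge_min lexx.
have te : t <= c + e / 4 by rewrite ge_min lexx orbT.
have Pst : P s t by apply: Pe; rewrite ?sc ?ct//; lra.
have Pat : P a t by apply: Ptrans Pas Pst => //; exact: le_trans ct.
have tc : t <= c by apply: ub_le_sup => //; split=> //; rewrite tb (le_trans ac).
have -> : b = t; last by [].
by apply/eqP; rewrite eq_le tb andbT; move: tc; rewrite ge_min => /orP[bc|]; lra.
Qed.

Section derive_le_integral.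
Context {R : realType}.
Local Notation mu := (@lebesgue_measure R).
Local Notation RB := (g_sigma_algebraType R.-ocitv.-measurable).
Local Notation borel := (@measurable _ RB).
Variables (f phi : R -> R) (a b : R).
Hypotheses (ab : a <= b) (df : forall x, derivable f x 1)
  (mphi : measurable_fun setT (phi : RB -> R)) (phi0 : forall x, 0 <= phi x)
  (fphi : forall x, f^`()%classic x <= phi x).

(** Straddle form of differentiability: since [x] lies between [s] and [t], the bounds on
    [f t - f x] and on [f x - f s] add up. *)
Let derive_lt (x c : R) : f^`()%classic x < c -> exists2 e, 0 < e &
  forall s t, s <= x <= t -> t - s < e -> f t - f s <= c * (t - s).
Proof.
move=> fxc.
have /cvgrPdist_lt/(_ (c - f^`()%classic x)) :
    h^-1 *: (f (h + x) - f x) @[h --> 0^'] --> f^`()%classic x.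
  by have := @df x; rewrite derive1E /derivable /derive; under eq_fun do rewrite scaler1.
rewrite subr_gt0 => /(_ fxc).
rewrite near_withinE nearE => -[e /= e0 He]; exists e => // s t /andP[sx xt] ts.
have H h : h != 0 -> `|h| < e -> h^-1 * (f (h + x) - f x) < c.
  move=> h0 he; have := He h; rewrite /ball/= sub0r normrN => /(_ he h0).
  by rewrite ltr_norml => /andP[]; rewrite /GRing.scale/=; lra.
have Ht : f t - f x <= c * (t - x).
  have [->|tx] := eqVneq t x; first by rewrite !subrr mulr0.
  have tx0 : 0 < t - x by rewrite subr_gt0 lt_neqAle eq_sym tx.
  have := H (t - x); rewrite gt_eqF// subrK => /(_ isT).
  rewrite gtr0_norm// mulrC ltr_pdivrMr// => /(_ _)/ltW; apply; lra.
have Hs : f x - f s <= c * (x - s).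
  have [->|tx] := eqVneq s x; first by rewrite !subrr mulr0.
  have tx0 : 0 < x - s by rewrite subr_gt0 lt_neqAle tx.
  have := H (s - x); rewrite subr_eq0 tx subrK => /(_ isT).
  rewrite ltr0_norm ?opprB; last by rewrite -oppr_gt0 opprB.
  rewrite -(opprB x s) invrN mulNr -mulrN opprB mulrC ltr_pdivrMr//.
  by move=> /(_ _)/ltW; apply; lra.
by nra.
Qed.

Let level (e : R) n := `[a, b]%classic `&` phi @^-1` `[n%:R * e, n.+1%:R * e[.

Let measurable_level e n : borel (level e n).
Proof.
apply: measurableI => //; rewrite -[X in measurable X]setTI; exact: mphi.
Qed.

Let level_mem e x : 0 < e -> a <= x <= b -> exists n, level e n x.
Proof.
move=> e0 xab; exists `|Num.floor (phi x / e)|%N; split => /=; first by rewrite in_itv.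
have p0 : 0 <= phi x / e by rewrite divr_ge0// ltW.
rewrite in_itv/= -ler_pdivlMr// -ltr_pdivrMr//.
have := floor_itv (phi x / e).
have fl0 : (0 <= Num.floor (phi x / e))%R by rewrite floor_ge0.
rewrite -[in X in X -> _](gez0_abs fl0) => /andP[h1 h2].
by rewrite h1/= (lt_le_trans h2)// intrD -natr1.
Qed.

Let level_triv e : 0 < e -> trivIset setT (level e).
Proof.
move=> e0; apply/trivIsetP => i j _ _ ij; apply/seteqP; split => // x [[_ xi] [_ xj]].
move: xi xj; rewrite /preimage/= !in_itv/= => /andP[h1 h2] /andP[h3 h4].
have : (i%:R : R) < j.+1%:R by rewrite -(ltr_pM2r e0) (le_lt_trans h1).
have : (j%:R : R) < i.+1%:R by rewrite -(ltr_pM2r e0) (le_lt_trans h3).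
rewrite !ltr_nat !ltnS => h5 h6; move: ij; rewrite neq_ltn.
by rewrite ltnNge h5 ltnNge h6.
Qed.

(* Cover each level set [n e <= phi < (n + 1) e] by a slightly larger open set
   [V n]; the increments of [f] are locally dominated by the integral of
   [\sum_n (n + 1) e 1_(V n)]. *)
Lemma increment_le_integral :
  ((f b - f a)%:E <= \int[mu]_(x in `[a, b]) (phi x)%:E)%E.
Proof.
have mab : mu `[a, b]%classic = (b - a)%:E.
  rewrite lebesgue_measure_itv/= lte_fin.
  case: ltP => // ba; have <- : a = b by apply/le_anti; rewrite ab.
  by rewrite subrr.
apply/lee_addgt0Pr => eps eps0.
(* Half of [eps] pays for rounding [phi] up to the next multiple of [e]. The [+ 1] in the
   denominator covers the case [a = b]. *)
have [e e0 ebound] : exists2 e, 0 < e & e * (b - a) <= eps / 2.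
  have ba0 : 0 < b - a + 1 by rewrite ltr_wpDl// subr_ge0.
  exists (eps / 2 / (b - a + 1)); first by rewrite !divr_gt0.
  rewrite mulrAC ler_pdivrMr//.
  by rewrite ler_pM2l ?divr_gt0// lerDl.
have mL n : borel (level e n) by exact: measurable_level.
(* The other half of [eps] pays for the excess of [V n], which is weighted by [(n + 1) e] in [U]:
   hence the division by this weight and by [2 ^ n.+1]. *)
have HV n : exists V : set R, [/\ open V, level e n `<=` V &
   (mu (V `\` level e n) < (eps / 2 / (2 ^ n.+1)%:R / (n.+1%:R * e))%:E)%E].
  apply: lebesgue_regularity_outer; first exact: mL.
    apply: (@le_lt_trans _ _ (mu `[a, b]%classic)); last by rewrite mab ltry.
    by apply: le_measure; rewrite ?inE//; exact: subIsetl.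
  by rewrite !divr_gt0// mulr_gt0.
pose V n := projT1 (cid (HV n)).
have [oV lV mV] : [/\ forall n, open (V n), forall n, level e n `<=` V n &
    forall n, (mu (V n `\` level e n) < (eps / 2 / (2 ^ n.+1)%:R / (n.+1%:R * e))%:E)%E].
  by split=> n; rewrite /V; case: cid => W [].
have mVn n : borel (V n) by exact: open_measurable.
pose u n x : \bar R := (n.+1%:R * e * \1_(V n) x)%:E.
have u0 n x : (0 <= u n x)%E by rewrite /u lee_fin mulr_ge0 ?mulr_ge0 ?ler0n ?ltW.
have mu_ n (D : set RB) : measurable_fun D (u n : RB -> \bar R).
  apply/measurable_EFinP; apply: measurable_funM => //.
pose U x := (\sum_(n <oo) u n x)%E.
have U0 x : (0 <= U x)%E by apply: nneseries_ge0.
have mU (D : set RB) : measurable_fun D (U : RB -> \bar R).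
  by apply: ge0_emeasurable_sum.
(* Half-open intervals make the integrals additive under concatenation. Locally, a point [x] of
   level [n] has derivative below [(n + 1) e], and [U] is at least this value on the neighbourhood
   [V n] of [x]. *)
have step1 : ((f b - f a)%:E <= \int[mu]_(x in `]a, b]) U x)%E.
  apply: (@cousin_segment _ (fun s t => ((f t - f s)%:E <= \int[mu]_(x in `]s, t]) U x)%E)) => //.
    move=> x y z xy yz Hxy Hyz.
    have -> : `]x, z]%classic = `]x, y]%classic `|` `]y, z]%classic :> set R.
      by rewrite -itv_bndbnd_setU// bnd_simp.
    rewrite ge0_integral_setU//=.
    - by rewrite (le_trans _ (leeD Hxy Hyz))// -EFinD lee_fin; lra.
    - apply/disj_set2P; apply/seteqP; split => // w [] /=.
      by rewrite !in_itv/= => /andP[_ h] /andP[]; rewrite ltNge h.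
  move=> x xab; have [n nx] := level_mem e0 xab.
  have fx : f^`()%classic x < n.+1%:R * e.
    by apply: le_lt_trans (fphi x) _; case: nx => _ /=; rewrite in_itv/= => /andP[].
  have [d d0 Hd] := derive_lt fx.
  have : nbhs x (V n) by apply: open_nbhs_nbhs; split => //; exact: lV.
  rewrite -nbhs_ballE => -[r /= r0 Hr].
  exists (Num.min d r); first by rewrite lt_min d0.
  move=> s t _ /[dup] /andP[sx xt] sxt _; rewrite lt_min => /andP[td tr].
  apply: (@le_trans _ _ (\int[mu]_(y in `]s, t]) (n.+1%:R * e)%:E)%E).
    rewrite integral_cst//= lebesgue_measure_itv/= lte_fin.
    have [st|st] := ltP s t; first by rewrite -EFinM lee_fin Hd.
    by have -> : s = t by [lra]; rewrite subrr mule0.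
  apply: ge0_le_integral => //.
    by move=> y _; rewrite lee_fin mulr_ge0// ltW.
  move=> y /=; rewrite in_itv/= => /andP[sy yt].
  apply: le_trans (nneseries_lim_ge n.+1 _) => //.
  rewrite big_nat_recr//= (le_trans _ (leeDr _ _)) ?sume_ge0//.
  rewrite /u indicE mem_set ?mulr1//; apply: Hr; rewrite /ball/=.
  by rewrite ltr_norml; lra.
apply: (le_trans step1).
apply: (@le_trans _ _ (\int[mu]_(x in `[a, b]) U x)%E).
  apply: ge0_subset_integral => //.
  exact: subset_itv_oc_cc.
rewrite integral_nneseries//.
(* On level [n] the weight [(n + 1) e] is at most [phi + e]; the rest of [V n] contributes a term of
   a geometric series. *)
apply: (@le_trans _ _ (\sum_(n <oo) (\int[mu]_(x in level e n) (phi x + e)%:E +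
    (eps / 2 / (2 ^ n.+1)%:R)%:E))%E).
  apply: lee_nneseries => [n _ _|n _]; first exact: integral_ge0.
  rewrite /u; under eq_integral do rewrite EFinM.
  have ne0 : 0 <= n.+1%:R * e by rewrite mulr_ge0// ltW.
  rewrite ge0_integralZl//=; last exact/measurable_EFinP.
  rewrite integral_indic//.
  apply: (@le_trans _ _ ((n.+1%:R * e)%:E * (mu (level e n) + mu (V n `\` level e n)))%E).
    rewrite lee_wpmul2l ?lee_fin//.
    rewrite -measureU//; first last.
    - by apply/seteqP; split => // x [? []].
    - exact: measurableD.
    apply: le_measure; rewrite ?inE.
    - exact: measurableI.
    - by apply: measurableU => //; exact: measurableD.
    - by move=> x [Vx _]; have [|] := pselect (level e n x); [left|right].
  rewrite ge0_muleDr// leeD//.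
    rewrite -integral_cst//; apply: ge0_le_integral => //=.
    - apply/measurable_EFinP; apply: measurable_funD => //.
      exact: measurable_funS mphi.
    - move=> x [_ /=]; rewrite in_itv/= => /andP[h _].
      by rewrite lee_fin -natr1; lra.
  rewrite muleC -lee_pdivlMr ?mulr_gt0//.
  exact: ltW.
apply: le_trans (epsilon_trick _ _ _) _.
- by move=> n; apply: integral_ge0 => x _; rewrite lee_fin addr_ge0// ltW.
- by rewrite divr_ge0// ltW.
rewrite -ge0_integral_bigcup//=; last 3 first.
- apply/measurable_EFinP; apply: measurable_funD => //.
  exact: measurable_funS mphi.
- by move=> x _; rewrite lee_fin addr_ge0// ltW.
- exact: level_triv.
have -> : \bigcup_k level e k = `[a, b]%classic.
  apply/seteqP; split => [x [n _ []//]|x /=]; rewrite in_itv/= => xab.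
  by have [n nx] := level_mem e0 xab; exists n.
under eq_integral do rewrite EFinD.
rewrite ge0_integralD//=; last 3 first.
- by move=> x _; rewrite lee_fin.
- by apply/measurable_EFinP; exact: measurable_funS mphi.
- by move=> x _; rewrite lee_fin ltW.
rewrite -addeA leeD2l// integral_cst//= mab -EFinM -EFinD lee_fin.
by rewrite [leRHS]splitr lerD2r.
Qed.

End derive_le_integral.

(** * The fundamental theorem of calculus for differentiable functions *)

Section ftc_derivable.
Context {R : realType}.
Local Notation mu := (@lebesgue_measure R).
Local Notation RB := (g_sigma_algebraType R.-ocitv.-measurable).

(** Truncating [g] below at [-n] and adding [n] gives a nonnegative majorant of the derivative of
    [G y + n y], to which [increment_le_integral] applies. The contributions of [n] cancel, and the
    truncation is removed by dominated convergence. *)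
Let ftc_le (G : R -> R) (g : RB -> R) a b : a <= b ->
  (forall x : R, is_derive x 1 G (g x)) -> measurable_fun setT g ->
  mu.-integrable `[a, b] (EFin \o g) ->
  ((G b - G a)%:E <= \int[mu]_(x in `[a, b]) (g x)%:E)%E.
Proof.
move=> ab dG mg ig.
pose h (n : nat) (x : RB) : R := Num.max (g x) (- n%:R).
have mh n : measurable_fun setT (h n) by exact: measurable_maxr.
have hle n x : `|h n x| <= `|g x|.
  rewrite /h; have [//|gn] := leP (- n%:R) (g x).
  have n0 : (0 : R) <= n%:R by [].
  by rewrite normrN normr_nat ler0_norm; lra.
have ih n : mu.-integrable `[a, b] (EFin \o h n).
  apply: le_integrable ig => //; first by apply/measurable_EFinP; exact: measurable_funS (mh n).
  by move=> x _; rewrite /= lee_fin.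
have mab : mu `[a, b]%classic = (b - a)%:E.
  rewrite lebesgue_measure_itv/= lte_fin.
  case: ltP => // ba; have <- : a = b by apply/le_anti; rewrite ab.
  by rewrite subrr.
have le_h n : ((G b - G a)%:E <= \int[mu]_(x in `[a, b]) (h n x)%:E)%E.
  have dGn (x : R) : is_derive x 1 (fun y => G y + n%:R * y) (g x + n%:R).
    by apply: is_derive_eq; rewrite [_ *: _]mulr1.
  have : ((G b + n%:R * b - (G a + n%:R * a))%:E <=
      \int[mu]_(x in `[a, b]) (h n x + n%:R)%:E)%E.
    apply: (@increment_le_integral R (fun x => G x + n%:R * x)
      (fun x => h n x + n%:R)) => //.
    - exact: measurable_funD.
    - by move=> x; rewrite /h; have [|] := leP (- n%:R) (g x); lra.
    - by move=> x; rewrite derive1E derive_val /h lerD2r le_max lexx.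
  under eq_integral do rewrite EFinD.
  rewrite integralD//=; last 2 first.
  - exact: ih.
  - apply/integrableP; split; first exact/measurable_EFinP.
    by rewrite /= integral_cst//= mab -EFinM ltry.
  rewrite integral_cst//= mab.
  have /fineK <- : (\int[mu]_(x in `[a, b]) (h n x)%:E)%E \is a fin_num.
    by apply: integrable_fin_num => //; exact: ih.
  by rewrite -EFinM -EFinD !lee_fin; lra.
have [_ _ cvg_h] : [/\ mu.-integrable `[a, b] (EFin \o g),
  [sequence \int[mu]_(x in `[a, b]) `|(h n x)%:E - (g x)%:E|]_n @ \oo --> 0%E &
  [sequence \int[mu]_(x in `[a, b]) (h n x)%:E]_n @ \oo --> \int[mu]_(x in `[a, b]) (g x)%:E]%E.
  apply: (@dominated_convergence _ _ _ mu `[a, b]%classic _ (fun n x => (h n x)%:E)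
    (EFin \o g) (abse \o (EFin \o g))) => //.
  - by move=> n; apply/measurable_EFinP; exact: measurable_funS (mh n).
  - by apply/measurable_EFinP; exact: measurable_funS mg.
  - apply: aeW => x _; apply: cvg_near_cst; near=> n; congr EFin.
    rewrite /h max_l// lerNl (le_trans (ler_norm _))// normrN.
    by near: n; exact: nbhs_infty_ger.
  - exact: integrable_abse.
  - by apply: aeW => x n _ /=; rewrite lee_fin.
by apply: (cvge_ge _ cvg_h); apply: nearW => n; exact: le_h.
Unshelve. all: by end_near. Qed.

(** The inequality [ftc_le] for [G] and for [- G]. *)
Lemma ftc_derivable (G : R -> R) (g : RB -> R) a b : a <= b ->
  (forall x : R, is_derive x 1 G (g x)) -> measurable_fun setT g ->
  mu.-integrable `[a, b] (EFin \o g) ->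
  (\int[mu]_(x in `[a, b]) (g x)%:E = (G b - G a)%:E)%E.
Proof.
move=> ab dG mg ig; apply/eqP; rewrite eq_le ftc_le// andbT.
have : ((- G b - - G a)%:E <= \int[mu]_(x in `[a, b]) (- g x)%:E)%E.
  apply: (@ftc_le (fun x => - G x)) => //; first exact: measurableT_comp.
  by have := integrableN ig.
under eq_integral do rewrite EFinN.
rewrite integralN ?integrable_add_def//.
by rewrite -opprD EFinN leeN2.
Qed.

End ftc_derivable.

(** * Vanishing of the integral of a derivative over the line *)

Section integral_derivative.
Context {R : realType}.
Local Notation mu := (@lebesgue_measure R).
Local Notation RB := (g_sigma_algebraType R.-ocitv.-measurable).
Variables (G : R -> R) (g : RB -> R) (c : R).
Hypotheses (dG : forall x : R, is_derive x 1 G (g x))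
  (ig : mu.-integrable setT (EFin \o g))
  (iG : mu.-integrable setT (fun x : RB => (((x : R) - c) * G x)%:E)).

Let mg : measurable_fun setT g.
Proof. by apply/measurable_EFinP; exact: (measurable_int mu ig). Qed.

Let out (n : nat) : set RB := ~` `[- n%:R, n%:R]%classic.

Let mout n : measurable (out n).
Proof. exact: measurableC. Qed.

Let tail (eps : R) : 0 < eps ->
  \forall n \near \oo, (\int[mu]_(x in out n) `|(g x)%:E| <= eps%:E)%E.
Proof.
move=> e0.
have iag : mu.-integrable setT (fun x => `|(g x)%:E|)%E by exact: integrable_abse.
have [_ _] : [/\ mu.-integrable setT (cst 0%E : RB -> \bar R),
  [sequence \int[mu]_x `|((fun x => `|(g x)%:E|) \_ (out n)) x - cst 0 x| ]_n @ \oo --> 0 &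
  [sequence \int[mu]_x (((fun x => `|(g x)%:E|) \_ (out n)) x)]_n @ \oo --> \int[mu]_x cst 0 x]%E.
  apply: (@dominated_convergence _ _ _ mu setT measurableT _ _ (fun x => `|(g x)%:E|%E)) => //.
  - move=> n; apply/(measurable_restrictT _ (mout n)).
    by apply: measurable_funTS; exact: measurable_int iag.
  - apply: aeW => x _; apply: cvg_near_cst; near=> n; rewrite patchE memNset//.
    apply; rewrite /= in_itv/= -ler_norml.
    by near: n; exact: nbhs_infty_ger.
  - apply: aeW => x n _; rewrite patchE; case: ifPn => _.
      by rewrite abse_id.
    by rewrite abse0.
rewrite integral0 => /fine_cvgP[_] /cvgrPdist_le/(_ _ e0); apply: filterS => n /=.
rewrite sub0r normrN => le_e; rewrite integral_mkcond.
have ir : mu.-integrable setT ((fun x => `|(g x)%:E|%E) \_ (out n)).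
  by apply/integrable_restrict => //; rewrite setTI; exact: integrableS iag.
rewrite -(fineK (integrable_fin_num _ ir))// lee_fin.
exact: le_trans (ler_norm _) le_e.
Unshelve. all: by end_near. Qed.

(** A value of modulus above [2 * eps] would keep [|G|] above [eps] on all of [J], hence also
    [|(x - c) G x|], whose integral over a set of infinite measure would diverge. *)
Let small (J : set RB) (eps : R) : measurable J -> mu J = +oo%E -> 0 < eps ->
  (forall x : R, J x -> 1 <= `|x - c|) ->
  (forall x y : R, J x -> J y -> `|G x - G y| <= eps) ->
  forall x : R, J x -> `|G x| <= 2 * eps.
Proof.
move=> mJ Joo e0 Jc JG x Jx; rewrite leNgt; apply/negP => Gx.
have /integrableP[mcG] := iG; apply/negP; rewrite -leNgt.
apply: (@le_trans _ _ (\int[mu]_(y in J) (cst eps%:E) y)%E).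
  by rewrite integral_cst//= Joo gt0_muley.
apply: (@le_trans _ _ (\int[mu]_(y in J) `|(((y : R) - c) * G y)%:E|)%E).
  apply: ge0_le_integral => //.
  - by move=> y _; rewrite lee_fin ltW.
  - by apply: measurableT_comp => //; exact: measurable_funS mcG.
  move=> y Jy; rewrite lee_fin normrM.
  have h1 := Jc _ Jy; have h2 := JG _ _ Jx Jy; have h3 := ler_distD 0 (G x) (G y).
  have := lerB_dist (G x) (G y) => h4.
  have h5 : eps <= `|G y| by lra.
  by rewrite -[leLHS]mul1r ler_pM// ltW.
by apply: ge0_subset_integral => //; exact: measurableT_comp.
Qed.

Let osc (n : nat) (eps : R) : (\int[mu]_(x in out n) `|(g x)%:E| <= eps%:E)%E ->
  forall x y : R, x <= y -> `[x, y]%classic `<=` out n -> `|G y - G x| <= eps.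
Proof.
move=> tn x y xy xyn.
have igxy : mu.-integrable `[x, y] (EFin \o g) by exact: integrableS ig.
rewrite -lee_fin -abse_EFin -(ftc_derivable xy dG mg igxy).
apply: le_trans (le_abse_integral _ _ _) _ => //.
  exact: measurable_int igxy.
apply: le_trans tn; apply: ge0_subset_integral => //.
by do 2 apply: measurableT_comp => //; exact: measurable_funTS.
Qed.

(* The integrability of [g] makes [G] converge at both infinities, and that of
   [(x - c) G x] forces the two limits to be zero. *)
Lemma integral_derive_eq0 : (\int[mu]_x (g x)%:E = 0)%E.
Proof.
apply/eqP; rewrite -abse_eq0 eq_le abse_ge0 andbT.
apply/lee_addgt0Pr => e e0; rewrite add0e.
(* Each of the two boundary values of [G] costs [2 * eps], and the tail of the integral costs
   [eps]. *)
pose eps := e / 5; have eps0 : 0 < eps by rewrite divr_gt0.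
(* The bound [|c| + 1 <= n] yields [1 <= |x - c|] outside [[-n, n]], as [small] requires. *)
have : \forall n \near \oo, (\int[mu]_(x in out n) `|(g x)%:E| <= eps%:E)%E /\
    `|c| + 1 <= n%:R.
  near=> n; split; near: n; [exact: tail|exact: nbhs_infty_ger].
move=> [n _ /(_ n (leqnn n))[tn nc]].
have nc' : c + 1 <= n%:R /\ - n%:R <= c - 1.
  by have := ler_norm c; have := ler_norm (- c); rewrite normrN; lra.
have GR : `|G (n%:R + 1)| <= 2 * eps.
  apply: (@small `]n%:R, +oo[%classic) => //.
  - by rewrite lebesgue_measure_itv/= ?ltry ?ltNyr.
  - by move=> x /=; rewrite in_itv/= andbT => nx; rewrite ger0_norm; lra.
  - have H x y : n%:R < x -> x <= y -> `|G x - G y| <= eps.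
      move=> nx xy; rewrite distrC; apply: osc tn _ _ xy _ => z.
      rewrite /out/= !in_itv/= => /andP[xz zy] /andP[]; lra.
    move=> x y /=; rewrite !in_itv/= !andbT => nx ny.
    by have [xy|/ltW yx] := leP x y; [exact: H|rewrite distrC; exact: H].
  - by rewrite /= in_itv/= andbT ltrDl.
have GL : `|G (- (n%:R + 1))| <= 2 * eps.
  apply: (@small `]-oo, - n%:R[%classic) => //.
  - by rewrite lebesgue_measure_itv/= ?ltry ?ltNyr.
  - by move=> x /=; rewrite in_itv/= => nx; rewrite ler0_norm; lra.
  - have H x y : y < - n%:R -> x <= y -> `|G x - G y| <= eps.
      move=> nx xy; rewrite distrC; apply: osc tn _ _ xy _ => z.
      rewrite /out/= !in_itv/= => /andP[xz zy] /andP[]; lra.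
    move=> x y /=; rewrite !in_itv/= => nx ny.
    by have [xy|/ltW yx] := leP x y; [exact: H|rewrite distrC; exact: H].
  - by rewrite /= in_itv/=; lra.
pose I : set RB := `[- (n%:R + 1), n%:R + 1]%classic.
have mI : measurable I by exact: measurable_itv.
have n0 : (0 : R) <= n%:R by [].
rewrite -(setUv I) integral_setU//; last 3 first.
- exact: measurableC.
- by rewrite setUv; exact/measurable_EFinP.
- by apply/disj_set2P; rewrite setICr.
rewrite (ftc_derivable _ dG)//; last 2 first.
- by lra.
- exact: integrableS ig.
apply: le_trans (lee_abs_add _ _) _.
have -> : e%:E = ((4 * eps)%:E + eps%:E)%E by rewrite -EFinD /eps; congr EFin; lra.
apply: leeD.
  by rewrite lee_fin; apply: le_trans (ler_normB _ _) _; lra.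
apply: le_trans (le_abse_integral _ _ _) _.
- exact: measurableC.
- by apply/measurable_EFinP; exact: measurable_funTS.
apply: le_trans tn; apply: ge0_subset_integral => //.
- exact: measurableC.
- by do 2 apply: measurableT_comp => //; exact: measurable_funTS.
- by apply: subsetC => x; rewrite /I /= !in_itv/= => /andP[]; lra.
Unshelve. all: by end_near. Qed.

End integral_derivative.

(** * Measures with a density *)

Section density.
Context {d} {T : measurableType d} {R : realType}.
Variables (mu nu : {measure set T -> \bar R}) (p : T -> R).
Hypotheses (mp : measurable_fun setT p) (p0 : forall x, 0 <= p x)
  (nuE : forall U, measurable U -> (nu U = \int[mu]_(x in U) (p x)%:E)%E).
Implicit Type f : T -> \bar R.

Import HBNNSimple.

Let mpE D : measurable_fun D (EFin \o p).
Proof. by apply/measurable_EFinP; exact: measurable_funTS. Qed.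

(** For simple functions this is [nuE] on each level set; monotone convergence along simple
    approximations gives the general case. *)
Lemma ge0_integral_density f : measurable_fun setT f -> (forall x, 0 <= f x)%E ->
  (\int[nu]_x f x = \int[mu]_x (f x * (p x)%:E))%E.
Proof.
move=> mf f0; pose h := nnsfun_approx measurableT mf.
have hf x : (h n x)%:E @[n --> \oo] --> f x by exact: cvg_nnsfun_approx.
have hnd x : {homo (fun n => (h n x)%:E) : n m / (n <= m)%N >-> (n <= m)%E}.
  by move=> n m nm; rewrite lee_fin; exact/lefP/nd_nnsfun_approx.
transitivity (limn (fun n => \int[nu]_x (h n x)%:E)%E).
  rewrite -monotone_convergence//.
  - by apply: eq_integral => x _; apply/esym/cvg_lim.
  - by move=> n; apply/measurable_EFinP; exact/measurable_funP.
  - by move=> n x _; rewrite lee_fin.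
transitivity (limn (fun n => \int[mu]_x ((h n x)%:E * (p x)%:E))%E); last first.
  rewrite -monotone_convergence//.
  - apply: eq_integral => x _; apply/cvg_lim => //.
    by apply: cvgeZr.
  - move=> n; apply: emeasurable_funM => //.
    by apply/measurable_EFinP; exact/measurable_funP.
  - by move=> n x _; rewrite mule_ge0 ?lee_fin.
  - by move=> x _ n m nm; rewrite lee_wpmul2r ?lee_fin// -lee_fin hnd.
congr (limn _); apply/funext => n.
rewrite integralT_nnsfun sintegralE.
under [RHS]eq_integral => x _.
  rewrite (fimfunE (h n) x) -fsumEFin//.
  rewrite ge0_mule_fsuml; last by move=> y; rewrite EFinM nnfun_muleindic_ge0.
  over.
have mhy y : measurable_fun setT (fun x => (y * \1_(h n @^-1` [set y]) x)%:E).
  by apply/measurable_EFinP; apply: measurable_funM => //; exact: measurable_indic.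
rewrite ge0_integral_fsum//; last 2 first.
- by move=> y; exact: emeasurable_funM.
- by move=> y x _; rewrite mule_ge0 ?lee_fin// -lee_fin EFinM nnfun_muleindic_ge0.
apply: eq_fsbigr => y; rewrite inE => -[x0 _ <-].
under eq_integral do rewrite EFinM -muleA.
rewrite ge0_integralZl//; last 3 first.
- apply: emeasurable_funM => //; apply/measurable_EFinP; exact: measurable_indic.
- by move=> x _; rewrite mule_ge0 ?lee_fin.
- by rewrite lee_fin.
rewrite nuE// [X in (_ = _ * X)%E](_ : _ =
    \int[mu]_x ((EFin \o p) \_ (h n @^-1` [set h n x0])) x)%E.
  by rewrite -integral_mkcond.
by apply: eq_integral => x _; rewrite epatch_indic/= muleC.
Qed.

Lemma integrable_density f : measurable_fun setT f ->
  nu.-integrable setT f <-> mu.-integrable setT (fun x => f x * (p x)%:E)%E.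
Proof.
move=> mf.
have mfp : measurable_fun setT (fun x => f x * (p x)%:E)%E by exact: emeasurable_funM.
have E : (\int[nu]_x `|f x| = \int[mu]_x `|f x * (p x)%:E|)%E.
  rewrite ge0_integral_density//; last exact: measurableT_comp.
  by apply: eq_integral => x _; rewrite abseM (@gee0_abs _ (p x)%:E) ?lee_fin.
by split => /integrableP[_ fi]; apply/integrableP; split => //; rewrite ?E// -?E.
Qed.

Lemma integral_density f : measurable_fun setT f ->
  (\int[nu]_x f x = \int[mu]_x (f x * (p x)%:E))%E.
Proof.
move=> mf; rewrite integralE [RHS]integralE; congr (_ - _)%E.
  rewrite ge0_integral_density//; last exact: measurable_funepos.
  by apply: eq_integral => x _; rewrite !funeposE maxe_pMl ?lee_fin// mul0e.
rewrite ge0_integral_density//; last exact: measurable_funeneg.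
by apply: eq_integral => x _; rewrite !funenegE -mulNe maxe_pMl ?lee_fin// mul0e.
Qed.

End density.

(** * The normal distribution *)

Section normal_stein.
Context {R : realType}.
Local Notation mu := (@lebesgue_measure R).
Local Notation RB := (g_sigma_algebraType R.-ocitv.-measurable).
Variables (m s : R).
Hypothesis s0 : s != 0.
Local Notation nu := (normal_prob m s : probability RB R).
Local Notation rho := (normal_pdf m s).

Let mrho : measurable_fun setT (rho : RB -> R).
Proof. exact: measurable_normal_pdf. Qed.

Let integrable_nu (f : RB -> R) : measurable_fun setT f ->
  nu.-integrable setT (EFin \o f) <->
  mu.-integrable setT (fun x => (f x * rho x)%:E).
Proof.
move=> mf; apply: (integrable_density mrho) => //.
- by move=> x; exact: normal_pdf_ge0.
- exact/measurable_EFinP.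
Qed.

Let integral_nu (f : RB -> R) : measurable_fun setT f ->
  (\int[nu]_x (f x)%:E = \int[mu]_x (f x * rho x)%:E)%E.
Proof.
move=> mf; rewrite (@integral_density _ _ _ mu nu rho)//.
- by move=> x; exact: normal_pdf_ge0.
- exact/measurable_EFinP.
Qed.

Let is_derive_rho (x : R) : is_derive x 1 rho (- ((x - m) / s ^+ 2) * rho x).
Proof.
have -> : rho = (fun x => normal_peak s * normal_fun m s x) by rewrite normal_pdfE.
rewrite /normal_fun; apply: is_derive_eq.
by rewrite /GRing.scale/=; field.
Qed.

(** The derivative of [F * rho] is [F' * rho - (x - m) * F * rho / s ^+ 2], and its integral over
    the line vanishes by [integral_derive_eq0]. *)
Lemma normal_stein (F : R -> R) (F' : RB -> R) :
  (forall x : R, is_derive x 1 F (F' x)) ->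
  nu.-integrable setT (fun x : RB => (((x : R) - m) * F x)%:E) ->
  nu.-integrable setT (EFin \o F') ->
  (\int[nu]_x (((x : R) - m) * F x)%:E = (s ^+ 2)%:E * \int[nu]_x (F' x)%:E)%E.
Proof.
move=> dF ixF iF'.
have mF' : measurable_fun setT F' by apply/measurable_EFinP; exact: measurable_int iF'.
have mxF : measurable_fun setT (fun x : RB => ((x : R) - m) * F x).
  by apply/measurable_EFinP; exact: measurable_int ixF.
have s20 : s ^+ 2 != 0 by rewrite expf_neq0.
have ixFr : mu.-integrable setT (fun x : RB => (((x : R) - m) * F x * rho x)%:E).
  exact/integrable_nu.
have iF'r : mu.-integrable setT (fun x : RB => (F' x * rho x)%:E).
  exact/integrable_nu.
pose g (x : RB) := F' x * rho x - (s ^+ 2)^-1 * (((x : R) - m) * F x * rho x).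
have izF : mu.-integrable setT (fun x : RB =>
    ((s ^+ 2)^-1%:E * (((x : R) - m) * F x * rho x)%:E)%E).
  exact: integrableZl.
have ig : mu.-integrable setT (EFin \o g).
  rewrite (_ : _ \o _ = (fun x : RB => (F' x * rho x)%:E) \-
    (fun x : RB => (s ^+ 2)^-1%:E * (((x : R) - m) * F x * rho x)%:E))%E.
    exact: integrableB.
  by apply/funext => x.
have := @integral_derive_eq0 R (fun x => F x * rho x) g m _ ig.
have dG (x : R) : is_derive x 1 (fun x => F x * rho x) (g x).
  have := is_derive_rho x => drho.
  by apply: is_derive_eq; rewrite /g /GRing.scale/=; field.
move=> /(_ dG); under eq_fun do rewrite mulrA.
move=> /(_ ixFr).
rewrite (_ : \int[mu]_x (g x)%:E = \int[mu]_x ((F' x * rho x)%:E - 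
  (s ^+ 2)^-1%:E * (((x : R) - m) * F x * rho x)%:E))%E//.
rewrite integralB// integralZl// => /eqP.
rewrite !integral_nu//.
rewrite -(fineK (integrable_fin_num _ iF'r))// -(fineK (integrable_fin_num _ ixFr))//.
rewrite -!EFinM -EFinB eqe subr_eq0 => /eqP ->.
by congr EFin; field.
Qed.

Lemma integrable_normal_sqr :
  nu.-integrable setT (fun x : RB => (((x : R) - m) ^+ 2)%:E).
Proof.
apply/integrable_nu.
  by apply: measurable_funX; exact: measurable_funB.
(* [u e^(-u) <= 1] bounds the integrand by a normal density of variance
   [2 s^2]. *)
pose t := Num.sqrt 2 * s.
have t0 : t != 0 by rewrite mulf_neq0// gt_eqF// sqrtr_gt0.
have t2 : t ^+ 2 = 2 * s ^+ 2 by rewrite exprMn sqr_sqrtr.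
pose c := 4 * s ^+ 2 * normal_peak s / normal_peak t.
have s2 : 0 < s ^+ 2 by rewrite exprn_even_gt0.
have ps := normal_peak_gt0 s0; have pt := normal_peak_gt0 t0.
have c0 : 0 <= c by rewrite ltW// /c divr_gt0// mulr_gt0// mulr_gt0.
apply: (@le_integrable _ _ _ mu _ _ _ (fun x : RB => (c%:E * (normal_pdf m t x)%:E)%E)) => //.
- apply/measurable_EFinP; apply: measurable_funM => //.
  by apply: measurable_funX; exact: measurable_funB.
- move=> x _; rewrite -EFinM !abse_EFin lee_fin.
  rewrite (ger0_norm (mulr_ge0 (sqr_ge0 _) (normal_pdf_ge0 _ _ _))).
  rewrite (ger0_norm (mulr_ge0 c0 (normal_pdf_ge0 _ _ _))).
  pose u := ((x : R) - m) ^+ 2 / (4 * s ^+ 2).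
  have xu : ((x : R) - m) ^+ 2 = 4 * s ^+ 2 * u by rewrite /u; field.
  have nsE : normal_fun m s x = expR (- u) * expR (- u).
    by rewrite -expRD /normal_fun /u; congr expR; field.
  have ntE : normal_fun m t x = expR (- u).
    by rewrite /normal_fun /u t2; congr expR; field.
  rewrite !normal_pdfE// nsE ntE xu /c.
  rewrite [leRHS](_ : _ = 4 * s ^+ 2 * normal_peak s * expR (- u)); last by field; rewrite gt_eqF.
  rewrite [leLHS](_ : _ = 4 * s ^+ 2 * normal_peak s * expR (- u) * (u * expR (- u))); last by ring.
  rewrite ler_piMr//; first by rewrite mulr_ge0 ?expR_ge0// ltW// mulr_gt0// mulr_gt0.
  rewrite expRN ler_pdivrMr ?expR_gt0// mul1r.
  by apply: le_trans (expR_ge1Dx u); rewrite lerDr.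
- by apply: integrableZl => //; exact: integrable_normal_pdf.
Qed.

Lemma integrable_normal_id : nu.-integrable setT (fun x : RB => ((x : R) - m)%:E).
Proof.
have i1 : nu.-integrable setT (fun x : RB => (1 + ((x : R) - m) ^+ 2)%:E).
  rewrite (_ : (fun _ => _) = (fun=> 1%:E) \+ (fun x : RB => (((x : R) - m) ^+ 2)%:E))%E//.
  by apply: integrableD => //; [exact: finite_measure_integrable_cst|exact: integrable_normal_sqr].
apply: le_integrable i1 => //.
  by apply/measurable_EFinP; exact: measurable_funB.
move=> x _; rewrite lee_fin [leRHS]ger0_norm ?addr_ge0 ?sqr_ge0//.
by rewrite -[X in _ <= _ + X]real_normK ?num_real//; nra.
Qed.

(** Stein's identity for the constant function 1. *)
Lemma normal_mean : (\int[nu]_x ((x : R) - m)%:E = 0)%E.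
Proof.
have d1 (x : R) : is_derive x 1 (fun=> 1 : R) 0 by exact: is_derive_cst.
have := normal_stein d1; under eq_integral do rewrite mulr1.
rewrite integral0 mule0; apply; last exact: integrable0.
by under eq_fun do rewrite mulr1; exact: integrable_normal_id.
Qed.

(** Stein's identity for [x - m]. *)
Lemma normal_variance : (\int[nu]_x (((x : R) - m) ^+ 2)%:E = (s ^+ 2)%:E)%E.
Proof.
have d1 (x : R) : is_derive x 1 (fun x => x - m) (1 : R).
  by apply: is_derive_eq; rewrite oppr0 addr0.
rewrite (normal_stein d1)//; first by rewrite integral_cst//= probability_setT !mule1.
- exact: integrable_normal_sqr.
- exact: finite_measure_integrable_cst.
Qed.

End normal_stein.

(** * The characteristic function of the centered normal distribution *)

Section normal_cos.
Context {R : realType}.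
Local Notation RB := (g_sigma_algebraType R.-ocitv.-measurable).

Lemma continuous_RB_measurable (f : R -> R) : continuous f ->
  measurable_fun setT (f : RB -> R).
Proof. exact: continuous_measurable_fun. Qed.

Lemma is_derive_sin_affine (a b x : R) :
  is_derive x 1 (fun x => sin (a * x + b)) (a * cos (a * x + b)).
Proof. by apply: is_derive_eq; rewrite /GRing.scale/=; ring. Qed.

Lemma is_derive_cos_affine (a b x : R) :
  is_derive x 1 (fun x => cos (a * x + b)) (- (a * sin (a * x + b))).
Proof. by apply: is_derive_eq; rewrite /GRing.scale/=; ring. Qed.

Lemma measurable_sin_affine (a b : R) :
  measurable_fun setT (fun x : RB => sin (a * (x : R) + b)).
Proof.
apply: continuous_RB_measurable => x; apply: differentiable_continuous.
by apply/derivable1_diffP; exact: (@ex_derive _ _ _ _ _ _ _ (is_derive_sin_affine a b x)).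
Qed.

Lemma measurable_cos_affine (a b : R) :
  measurable_fun setT (fun x : RB => cos (a * (x : R) + b)).
Proof.
apply: continuous_RB_measurable => x; apply: differentiable_continuous.
by apply/derivable1_diffP; exact: (@ex_derive _ _ _ _ _ _ _ (is_derive_cos_affine a b x)).
Qed.

Lemma integrable_bounded1 d (T : measurableType d) (P : probability T R) (f : T -> R) :
  measurable_fun setT f -> (forall x, `|f x| <= 1) -> P.-integrable setT (EFin \o f).
Proof.
move=> mf f1; apply: (@le_integrable _ _ _ P _ _ _ (cst 1%E)) => //.
- exact/measurable_EFinP.
- by move=> x _ /=; rewrite lee_fin normr1.
- exact: finite_measure_integrable_cst.
Qed.

Variables (s theta : R).
Hypothesis s0 : s != 0.
Local Notation nu := (normal_prob 0 s : probability RB R).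

(** The phase [theta] encodes the real and imaginary parts of the characteristic function in one
    real integral. *)
Let y (t : R) : R := (\int[nu]_x cos (t * (x : R) + theta))%R.

Let integrable_cos t : nu.-integrable setT (fun x : RB => (cos (t * (x : R) + theta))%:E).
Proof.
by apply: integrable_bounded1; [exact: measurable_cos_affine|move=> x; exact: cos_max].
Qed.

Let integrable_x : nu.-integrable setT (fun x : RB => (x : R)%:E).
Proof. by have := integrable_normal_id 0 s0; under eq_fun do rewrite subr0. Qed.

Let integrable_xsin t :
  nu.-integrable setT (fun x : RB => ((x : R) * sin (t * (x : R) + theta))%:E).
Proof.
apply: le_integrable integrable_x => //.
  apply/measurable_EFinP; apply: measurable_funM; last exact: measurable_sin_affine.
  exact: measurable_id.
by move=> x _; rewrite lee_fin normrM ler_piMr// sin_max.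
Qed.

Let integral_xsin t : (\int[nu]_x ((x : R) * sin (t * (x : R) + theta))%:E =
  (s ^+ 2 * t * y t)%:E)%E.
Proof.
transitivity (\int[nu]_x (((x : R) - 0) * sin (t * (x : R) + theta))%:E)%E.
  by apply: eq_integral => x _; rewrite subr0.
have it : nu.-integrable setT (fun x : RB => (t%:E * (cos (t * (x : R) + theta))%:E)%E).
  exact: integrableZl.
rewrite (normal_stein s0 (F' := fun x : RB => t * cos (t * (x : R) + theta))
  (is_derive_sin_affine t theta))//; last by under eq_fun do rewrite subr0.
under eq_integral do rewrite EFinM.
rewrite integralZl//; last exact: integrable_cos.
rewrite -(fineK (integrable_fin_num _ (integrable_cos t)))//.
by rewrite -!EFinM mulrA.
Qed.

(** Differentiation under the integral sign, with [|x|] as dominating function, followed by Stein's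
    identity for the sine. *)
Let is_derive_y (t : R) : is_derive t 1 y (- (s ^+ 2 * t * y t)).
Proof.
have dcos (u : R) (x : RB) : is_derive u 1 (fun u => cos (u * (x : R) + theta))
    (- ((x : R) * sin (u * (x : R) + theta))).
  by apply: is_derive_eq; rewrite /GRing.scale/=; ring.
have It : `]t - 1, t + 1[%classic t by rewrite /= in_itv/=; lra.
pose f (u : R) (x : RB) := cos (u * (x : R) + theta).
have d1f u x : partial1of2 f u x = - ((x : R) * sin (u * (x : R) + theta)).
  by rewrite partial1of2E (@derive_val _ _ _ _ _ _ _ (dcos u x)).
have intf u : `]t - 1, t + 1[%classic u -> nu.-integrable setT (EFin \o f u).
  by move=> _; exact: integrable_cos.
have derf u x : `]t - 1, t + 1[%classic u -> setT x -> derivable (f^~ x) u 1.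
  by move=> _ _; exact: (@ex_derive _ _ _ _ _ _ _ (dcos u x)).
have intG : nu.-integrable setT (EFin \o (fun x : RB => `|(x : R)|)).
  exact: (integrable_norm integrable_x).
have G_ub u x : `]t - 1, t + 1[%classic u -> setT x -> `|partial1of2 f u x| <= `|(x : R)|.
  by move=> _ _; rewrite d1f normrN normrM ler_piMr// sin_max.
apply: DeriveDef.
  exact: (derivable_under_integral measurableT It intf derf (fun=> normr_ge0 _) intG G_ub).
rewrite -derive1E (differentiation_under_integral measurableT It intf derf
  (fun=> normr_ge0 _) intG G_ub).
rewrite /Rintegral; under eq_integral do rewrite d1f EFinN.
rewrite integralN; last by apply: integrable_add_def => //; exact: integrable_xsin.
by rewrite integral_xsin.
Qed.

Lemma normal_cos t : (\int[nu]_x (cos (t * (x : R) + theta))%:E =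
  (expR (- (s ^+ 2 * t ^+ 2 / 2)) * cos theta)%:E)%E.
Proof.
have -> : (\int[nu]_x (cos (t * (x : R) + theta))%:E = (y t)%:E)%E.
  by rewrite /y /Rintegral fineK//; exact: (integrable_fin_num _ (integrable_cos t)).
(* Stein's identity yields [y' = - s^2 t y]. *)
pose z u := expR (s ^+ 2 * u ^+ 2 / 2) * y u.
have dz (u : R) : is_derive u 1 z 0.
  have := is_derive_y u => dy.
  by apply: is_derive_eq; rewrite /GRing.scale/=; field.
have := is_derive_0_is_cst t 0 dz.
rewrite /z expr0n/= mulr0 mul0r expR0 mul1r => zt.
have y0 : y 0 = cos theta.
  rewrite /y; under eq_Rintegral do rewrite mul0r add0r.
  by rewrite Rintegral_cst//= probability_setT mulr1.
by rewrite -y0 -zt mulrA -expRD addNr expR0 mul1r.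
Qed.

End normal_cos.

(** * Uniqueness of probability measures on tempered distributions *)

Section tempered_linear.
Context {R : realType} {d : nat}.
Implicit Types (phi : tempered R d) (f g : schwartz R d).

Lemma tempered_linear phi : linear (phi : schwartz R d -> R^o).
Proof. by have /asboolP[] := tempered_funP phi. Qed.

Lemma temperedD phi f g : phi (f + g) = phi f + phi g.
Proof. by have := tempered_linear phi 1 f g; rewrite !scale1r. Qed.

Lemma tempered0 phi : phi 0 = 0.
Proof. by have := temperedD phi 0 0; rewrite addr0; lra. Qed.

Lemma temperedZ phi (a : R) f : phi (a *: f) = a * phi f.
Proof. by have := tempered_linear phi a f 0; rewrite !addr0 tempered0 addr0. Qed.

Lemma temperedB phi f g : phi (f - g) = phi f - phi g.
Proof. by rewrite temperedD -scaleN1r temperedZ mulN1r. Qed.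

End tempered_linear.

Section sign_iteration.
Context {R : realType}.

(* The iterates of this map converge to the sign on [-1, 1], which exhibits the
   sign function as a bounded limit of polynomials. *)
Definition cubic (y : R) := y * (3 - y ^+ 2) / 2.

Lemma iter_cubicN n (y : R) : iter n cubic (- y) = - iter n cubic y.
Proof. by elim: n => //= n ->; rewrite /cubic; field. Qed.

(** Since [1 - cubic z = (1 - z) ^+ 2 * (2 + z) / 2], the iterates stay in [[y, 1]], and each step
    contracts the distance to 1 by the factor [q = 1 - y / 2]. *)
Lemma iter_cubic_cvg1 (y : R) : 0 < y -> y <= 1 ->
  iter n cubic y @[n --> \oo] --> (1 : R).
Proof.
move=> y0 y1; pose q := 1 - y / 2.
have q1 : `|q| < 1 by rewrite /q ltr_norml; lra.
have H n : y <= iter n cubic y <= 1 /\ 1 - iter n cubic y <= q ^+ n.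
  elim: n => [|n [/andP[h1 h2] h3]]; first by rewrite expr0 /=; lra.
  rewrite iterS exprS; set z := iter n cubic y in h1 h2 h3 *.
  have E : 1 - cubic z = (1 - z) * ((1 - z) * (2 + z) / 2) by rewrite /cubic; field.
  have E0 : 0 <= (1 - z) * (2 + z) / 2 by rewrite divr_ge0// mulr_ge0; lra.
  have Eq : (1 - z) * (2 + z) / 2 <= q by rewrite /q; nra.
  have z1 : 0 <= 1 - z by lra.
  have D : 1 - cubic z <= q * (1 - z) by rewrite E mulrC ler_wpM2r.
  have q0 : 0 <= q by rewrite /q; lra.
  split; last by apply: le_trans D _; rewrite ler_wpM2l.
  apply/andP; split; last by rewrite -subr_ge0 E mulr_ge0.
  by move: D; rewrite /q => D; nra.
apply: (@squeeze_cvgr _ _ _ _ (fun n => 1 - q ^+ n) (fun=> 1)).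
- by apply: nearW => n; have [/andP[_ ->] h] := H n; rewrite andbT; lra.
- rewrite -[X in _ --> X]subr0; apply: cvgB; first exact: cvg_cst.
  by have := cvg_geometric 1 q1; rewrite /geometric/=; under eq_fun do rewrite mul1r.
- exact: cvg_cst.
Qed.

Lemma iter_cubic_cvg (y : R) : `|y| <= 1 -> iter n cubic y @[n --> \oo] --> Num.sg y.
Proof.
rewrite ler_norml => /andP[y1 y2]; have [y0|y0|->] := ltgtP y 0.
- rewrite -[y]opprK sgrN gtr0_sg ?oppr_gt0//; under eq_fun do rewrite iter_cubicN.
  by apply: cvgN; apply: iter_cubic_cvg1; lra.
- by rewrite gtr0_sg//; exact: iter_cubic_cvg1.
- rewrite sgr0; apply: cvg_near_cst; apply: nearW; elim=> //= n ->.
  by rewrite /cubic mul0r mul0r.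
Qed.

End sign_iteration.

Lemma cosM {R : realType} (a b : R) :
  cos a * cos b = 2^-1 * cos (a + b) + 2^-1 * cos (a - b).
Proof. by rewrite cosD cosB; field. Qed.

Section trig_closure.
Context {R : realType} {d : nat}.
Local Notation S' := (tempered R d).
Local Notation RB := (g_sigma_algebraType R.-ocitv.-measurable).
Implicit Type f : S' -> R.

(* A class which contains the characters, hence on which two measures with the
   same characteristic function agree, and which turns out to be stable under
   products, hence to contain the indicator of every measurable set. *)
Inductive trig_closure : (S' -> R) -> Prop :=
| trig_cos g (theta : R) : trig_closure (fun phi => cos (phi g + theta))
| trig_add f1 f2 : trig_closure f1 -> trig_closure f2 ->
    trig_closure (fun phi => f1 phi + f2 phi)
| trig_scale a f : trig_closure f -> trig_closure (fun phi => a * f phi)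
| trig_lim (f_ : nat -> S' -> R) f M : (forall n, trig_closure (f_ n)) ->
    (forall n phi, `|f_ n phi| <= M) ->
    (forall phi, f_ n phi @[n --> \oo] --> f phi) -> trig_closure f.

Lemma trig_bounded f : trig_closure f -> exists M : R, forall phi, `|f phi| <= M.
Proof.
elim=> {f} [g theta|f1 f2 _ [M1 H1] _ [M2 H2]|a f _ [M H]|f_ f M _ _ fM fl].
- by exists 1 => phi; exact: cos_max.
- by exists (M1 + M2) => phi; rewrite (le_trans (ler_normD _ _))// lerD.
- by exists (`|a| * M) => phi; rewrite normrM ler_wpM2l.
- exists M => phi.
  have cn : `|f_ n phi| @[n --> \oo] --> `|f phi| by apply: cvg_norm; exact: fl.
  rewrite -(cvg_lim _ cn)//; apply: limr_le; first exact: cvgP cn.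
  by apply: nearW.
Qed.

(** The product of two cosines is a combination of cosines of the sum and of the difference of their
    arguments, and these are again values of [phi] at test functions, up to a phase. *)
Lemma trig_mul_cos g (theta : R) f : trig_closure f ->
  trig_closure (fun phi => cos (phi g + theta) * f phi).
Proof.
elim=> {f} [g' theta'|f1 f2 _ H1 _ H2|a f _ H|f_ f M _ H fM fl].
- rewrite (_ : (fun _ => _) = (fun phi : S' =>
    2^-1 * cos (phi (g + g') + (theta + theta')) +
    2^-1 * cos (phi (g - g') + (theta - theta')))); last first.
    apply/funext => phi; rewrite temperedD temperedB.
    have -> : phi g + phi g' + (theta + theta') = (phi g + theta) + (phi g' + theta') by ring.
    have -> : phi g - phi g' + (theta - theta') = (phi g + theta) - (phi g' + theta') by ring.
    exact: cosM.
  by apply: trig_add; apply: trig_scale; exact: trig_cos.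
- by under eq_fun do rewrite mulrDr; exact: trig_add.
- by under eq_fun do rewrite mulrCA; exact: trig_scale.
- apply: (trig_lim (M := M) H) => [n phi|phi].
    by rewrite normrM (le_trans _ (fM n phi))// ler_piMl// cos_max.
  by apply: cvgM => //; exact: cvg_cst.
Qed.

(** Induction on [f1] with [trig_mul_cos] as base case; the bound on [f2] keeps the limits
    bounded. *)
Lemma trig_mul f1 f2 : trig_closure f1 -> trig_closure f2 ->
  trig_closure (fun phi => f1 phi * f2 phi).
Proof.
move=> + cf2; have [M2 HM2] := trig_bounded cf2.
elim=> {f1} [g theta|f1 f3 _ H1 _ H3|a f _ H|f_ f M _ H fM fl].
- exact: trig_mul_cos.
- by under eq_fun do rewrite mulrDl; exact: trig_add.
- by under eq_fun do rewrite -mulrA; exact: trig_scale.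
- apply: (trig_lim (M := M * M2) H) => [n phi|phi].
    by rewrite normrM ler_pM.
  by apply: cvgM => //; exact: cvg_cst.
Qed.

Lemma trig_cst (c : R) : trig_closure (fun=> c).
Proof.
rewrite (_ : (fun=> c) = (fun phi : S' => c * cos (phi 0 + 0))).
  by apply: trig_scale; exact: trig_cos.
by apply/funext => phi; rewrite tempered0 addr0 cos0 mulr1.
Qed.

Lemma trig_onem f : trig_closure f -> trig_closure (fun phi => 1 - f phi).
Proof.
move=> cf; under eq_fun do rewrite -mulN1r.
by apply: trig_add; [exact: trig_cst|exact: trig_scale].
Qed.

Lemma trig_sg f : trig_closure f -> (forall phi, `|f phi| <= 1) ->
  trig_closure (fun phi => Num.sg (f phi)).
Proof.
move=> cf f1.
have cub n : trig_closure (fun phi => iter n cubic (f phi)).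
  elim: n => //= n IH.
  rewrite (_ : (fun _ => _) = (fun phi => 2^-1 * (iter n cubic (f phi) *
    (3 + -1 * (iter n cubic (f phi) * iter n cubic (f phi)))))); last first.
    by apply/funext => phi; rewrite /cubic; field.
  apply: trig_scale; apply: trig_mul => //; apply: trig_add; first exact: trig_cst.
  by apply: trig_scale; exact: trig_mul.
have cub1 (y : R) : `|y| <= 1 -> `|cubic y| <= 1.
  rewrite /cubic !ler_norml => /andP[y1 y2].
  (* These two products are [2 * (1 - cubic y)] and [2 * (1 + cubic y)]. *)
  have h1 : 0 <= (1 - y) ^+ 2 * (2 + y) by rewrite mulr_ge0 ?sqr_ge0//; lra.
  have h2 : 0 <= (1 + y) ^+ 2 * (2 - y) by rewrite mulr_ge0 ?sqr_ge0//; lra.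
  by apply/andP; split; nra.
apply: (trig_lim (M := 1) cub) => [n phi|phi].
  by elim: n => [|n IH] /=; [exact: f1|exact: cub1].
by apply: iter_cubic_cvg.
Qed.

(** The sine of [(phi g - a) / n.+1] is a cosine up to a phase, is bounded by 1, and has the sign of
    [phi g - a] as soon as [|phi g - a| < n.+1 * pi]. *)
Lemma trig_indic_gt g (a : R) : trig_closure (fun phi => ((a < phi g)%R)%:R).
Proof.
have csg : trig_closure (fun phi : S' => Num.sg (phi g - a)).
  have csin n : trig_closure (fun phi : S' => Num.sg (sin ((phi g - a) / n.+1%:R))).
    apply: trig_sg; last by move=> phi; exact: sin_max.
    rewrite (_ : (fun _ => _) = (fun phi : S' =>
      cos (phi (n.+1%:R^-1 *: g) + (- a / n.+1%:R - pi / 2)))); first exact: trig_cos.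
    apply/funext => phi; rewrite temperedZ -cosBpihalf; congr cos; ring.
  apply: (trig_lim (M := 1) csin) => [n phi|phi].
    by rewrite normr_sg; case: eqP.
  apply: cvg_near_cst; near=> n.
  have xpi : `|phi g - a| < n.+1%:R * pi.
    rewrite -ltr_pdivrMr ?pi_gt0//; apply: (@lt_trans _ _ n%:R); last by rewrite ltr_nat.
    by near: n; exact: nbhs_infty_gtr.
  have n0 : (0 : R) < n.+1%:R by [].
  have [x0|x0|->] := ltgtP (phi g - a) 0.
  - rewrite !ltr0_sg// -oppr_gt0 -sinN sin_gt0_pi// -mulNr divr_gt0 ?oppr_gt0//=.
    by rewrite ltr_pdivrMr// mulrC -ltr0_norm.
  - rewrite !gtr0_sg// sin_gt0_pi// divr_gt0//= ltr_pdivrMr// mulrC.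
    by rewrite -[X in X < _]gtr0_norm.
  - by rewrite mul0r sin0.
(* The indicator of the positive reals is half the sum of the sign and of its square. *)
rewrite (_ : (fun _ => _) = (fun phi : S' =>
  2^-1 * (Num.sg (phi g - a) * Num.sg (phi g - a) + Num.sg (phi g - a)))).
  by apply: trig_scale; apply: trig_add => //; exact: trig_mul.
apply/funext => phi; rewrite -subr_gt0.
case: sgrP => _ /=.
- by rewrite mulr0 addr0 mulr0.
- by rewrite mulr1 -mulr2n mulVf.
- by rewrite mulrNN mulr1 subrr mulr0.
Unshelve. all: by end_near. Qed.

Let indic_onem (A : set S') (phi : S') : \1_(~` A) phi = 1 - \1_A phi :> R.
Proof. by rewrite !indicE in_setC; case: (phi \in A); rewrite /= ?subr0 ?subrr. Qed.

(** The sets whose indicator is in the class form a sigma-algebra, by stability under products,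
    complements to 1 and bounded limits. It contains the cylinders because the intervals []a, b]]
    generate the Borel sets. *)
Lemma trig_indic_measurable (U : set S') : measurable U ->
  trig_closure (\1_U : S' -> R).
Proof.
suff : <<s cylinders (R := R) (d := d) >> `<=` [set U | trig_closure (\1_U : S' -> R)].
  exact.
have trigC (A : set S') : trig_closure (\1_A : S' -> R) -> trig_closure (\1_(~` A) : S' -> R).
  move=> cA; rewrite (_ : \1_(~` A) = (fun phi : S' => 1 - \1_A phi : R)).
    exact: trig_onem.
  by apply/funext => phi; exact: indic_onem.
have trig0 : trig_closure (\1_(set0 : set S') : S' -> R) by rewrite indic0; exact: trig_cst.
have trigU (A : (set S')^nat) : (forall n, trig_closure (\1_(A n) : S' -> R)) ->
    trig_closure (\1_(\bigcup_n A n) : S' -> R).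
  (* [w n] is the indicator of the complement of the union of the first [n] sets; it is eventually
     constant at every point. *)
  move=> cA; pose w n (phi : S') : R := \prod_(i < n) (1 - \1_(A i) phi).
  have cw n : trig_closure (w n).
    elim: n => [|n IH]; rewrite /w.
      by under eq_fun do rewrite big_ord0; exact: trig_cst.
    by under eq_fun do rewrite big_ord_recr; apply: trig_mul => //; exact: trig_onem.
  rewrite -[\bigcup_n A n]setCK; apply: trigC.
  have w1 i phi : 0 <= 1 - (\1_(A i) phi : R) <= 1.
    by rewrite indicE; case: (_ \in _); rewrite /= ?subr0 ?subrr ?lexx ?ler01.
  apply: (trig_lim (M := 1) cw) => [n phi|phi].
    rewrite /w normr_prod; apply: prodr_ile1 => i _.
    by have /andP[h1 h2] := w1 i phi; rewrite normr_ge0/= ger0_norm.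
  apply: cvg_near_cst; rewrite indicE.
  have [[k _ Ak]|nA] := pselect ((\bigcup_n A n) phi).
    rewrite memNset; last by move=> /(_ _); apply; exists k.
    exists k.+1 => // n /= kn; rewrite /w (bigD1 (Ordinal kn))//= indicE mem_set//.
    by rewrite subrr mul0r.
  rewrite mem_set//; apply: nearW => n; rewrite /w big1// => i _.
  by rewrite indicE memNset ?subr0// => Ai; apply: nA; exists i.
apply: smallest_sub.
  by split => // A cA; rewrite setTD; exact: trigC.
move=> _ [g _ [B mB <-]].
suff : @measurable _ (measurableTypeR R) `<=`
    [set B | trig_closure (\1_((fun phi : S' => phi g) @^-1` B) : S' -> R)].
  exact.
apply: smallest_sub.
  split => [|A cA|A cA] /=.
  - by rewrite preimage_set0.
  - by rewrite setTD preimage_setC; exact: trigC.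
  - by rewrite preimage_bigcup; exact: trigU.
move=> _ [[a b] _ <-] /=.
rewrite (_ : \1__ = (fun phi : S' => (a < phi g)%R%:R * (1 - (b < phi g)%R%:R) : R)).
  by apply: trig_mul; [|apply: trig_onem]; exact: trig_indic_gt.
apply/funext => phi; rewrite indicE.
have -> : (phi \in (fun phi : S' => phi g) @^-1` `]a, b]%classic) = (a < phi g <= b).
  by apply/idP/idP; rewrite inE /= in_itv.
by rewrite leNgt; case: (a < _); case: (b < _); rewrite /= ?subrr ?subr0 ?mulr0 ?mulr1 ?mul0r.
Qed.

(** Linearity and dominated convergence propagate the equality from the cosines. Measurability is
    carried through the same induction, as both arguments use it at every stage. *)
Lemma trig_integral (P Q : probability S' R) f : trig_closure f ->
  (forall g (theta : R), \int[P]_phi (cos (phi g + theta))%:E =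
                   \int[Q]_phi (cos (phi g + theta))%:E)%E ->
  measurable_fun setT f /\ (\int[P]_phi (f phi)%:E = \int[Q]_phi (f phi)%:E)%E.
Proof.
move=> cf PQ.
have bint (Q' : probability S' R) h : measurable_fun setT h -> trig_closure h ->
    Q'.-integrable setT (fun phi => (h phi)%:E).
  move=> mh /trig_bounded[M hM].
  apply: (@le_integrable _ _ _ Q' _ _ _ (cst M%:E)) => //.
  - exact/measurable_EFinP.
  - by move=> phi _ /=; rewrite lee_fin (le_trans (hM phi))// ler_norm.
  - exact: finite_measure_integrable_cst.
elim: cf => {f} [g theta|f1 f2 c1 [m1 E1] c2 [m2 E2]|a f c [m E]|f_ f M c mE fM fl].
- split; last exact: PQ.
  rewrite (_ : (fun _ => _) = (fun x : RB => cos (1 * (x : R) + theta)) \o ev g).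
    by apply: measurableT_comp; [exact: measurable_cos_affine|exact: measurable_ev].
  by apply/funext => phi; rewrite /= mul1r.
- split; first exact: measurable_funD.
  under eq_integral do rewrite EFinD; rewrite integralD//; [|exact: bint..].
  by under [RHS]eq_integral do rewrite EFinD; rewrite integralD ?E1 ?E2//; exact: bint.
- split; first exact: measurable_funM.
  under eq_integral do rewrite EFinM; rewrite integralZl//; last exact: bint.
  by under [RHS]eq_integral do rewrite EFinM; rewrite integralZl ?E//; exact: bint.
have mf : measurable_fun setT f.
  by apply: (measurable_fun_cvg (fun n => (mE n).1)) => phi _; exact: fl.
split => //.
have dom (Q' : probability S' R) :
    (\int[Q']_phi (f_ n phi)%:E)%E @[n --> \oo] --> (\int[Q']_phi (f phi)%:E)%E.
  have [_ _] : [/\ Q'.-integrable setT (fun phi => (f phi)%:E),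
    [sequence \int[Q']_phi `|(f_ n phi)%:E - (f phi)%:E|]_n @ \oo --> 0%E &
    [sequence \int[Q']_phi (f_ n phi)%:E]_n @ \oo --> \int[Q']_phi (f phi)%:E]%E.
    apply: (@dominated_convergence _ _ _ Q' setT measurableT _ _ (cst M%:E)).
    - by move=> n; apply/measurable_EFinP; exact: (mE n).1.
    - exact/measurable_EFinP.
    - by apply: aeW => phi _; apply: cvg_EFin; [exact: nearW|exact: fl].
    - exact: finite_measure_integrable_cst.
    - by apply: aeW => phi n _; rewrite /= lee_fin.
  exact.
rewrite -(cvg_lim _ (dom P))// -(cvg_lim _ (dom Q))//.
by congr (limn _); apply/funext => n; exact: (mE n).2.
Qed.

Lemma tempered_probability_unique (P Q : probability S' R) :
  (forall g (theta : R), \int[P]_phi (cos (phi g + theta))%:E =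
                   \int[Q]_phi (cos (phi g + theta))%:E)%E ->
  forall U, measurable U -> P U = Q U.
Proof.
move=> PQ U mU; have [_] := trig_integral (trig_indic_measurable mU) PQ.
by rewrite !integral_indic// !setIT.
Qed.

End trig_closure.

(** * One-dimensional marginals *)

(** Change of variables for a measure given by its own formula and known to agree with an image
    measure on measurable sets. It serves for the laws of [phi f] and for the invariance of [mu]
    under [shift_to]. *)
Lemma integral_image d1 d2 (X : measurableType d1) (Y : measurableType d2)
    (R : realType) (m : {measure set X -> \bar R}) (nu : {measure set Y -> \bar R})
    (Phi : X -> Y) (g : Y -> R) : measurable_fun setT Phi ->
  (forall U, measurable U -> nu U = m (Phi @^-1` U)) ->
  nu.-integrable setT (EFin \o g) ->
  m.-integrable setT (fun x => (g (Phi x))%:E) /\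
  (\int[nu]_y (g y)%:E = \int[m]_x (g (Phi x))%:E)%E.
Proof.
move=> mPhi nuE ig; have mg := measurable_int _ ig.
have nuI f : (\int[nu]_y f y = \int[pushforward m Phi]_y f y)%E.
  pose p : {measure set Y -> \bar R} :=
    measure_function_pushforward__canonical__measure_function_Measure m mPhi.
  rewrite (_ : pushforward m Phi = p)//.
  by apply: eq_measure_integral => A mA _; rewrite nuE.
have iPhi : m.-integrable setT (fun x => (g (Phi x))%:E).
  apply/integrableP; split; first exact: (measurableT_comp mg).
  have /integrableP[_] := ig; rewrite nuI ge0_integral_pushforward//.
  exact: measurableT_comp.
by split => //; rewrite nuI integral_pushforward.
Qed.

Section gaussian_law.
Context {R : realType} {d : nat}.
Local Notation S := (schwartz R d).
Local Notation S' := (tempered R d).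
Local Notation RB := (g_sigma_algebraType R.-ocitv.-measurable).
Variables (mu : probability S' R) (C : S -> S).
Hypothesis gmu : centered_gaussian mu C.
Implicit Types f g h : S.

Lemma covariance_sym f g : inner f (C g) = inner g (C f).
Proof. by apply: EFin_inj; rewrite -!(covariance_ev gmu) covarianceC. Qed.

Lemma covariance_integral f g :
  (\int[mu]_phi (phi f * phi g)%:E = (inner f (C g))%:E)%E.
Proof.
rewrite -(covariance_ev gmu) covariance.unlock !(centered_ev gmu) expectation.unlock.
by apply: eq_integral => phi _; rewrite !fctE/= !subr0.
Qed.

(** The parameters are identified by the first two moments: the mean gives [m = 0] and the
    covariance gives [s ^+ 2], in the Dirac case as in the normal one. *)
Lemma gaussian_ev_law f : exists2 s : R, s ^+ 2 = inner f (C f) &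
  forall U : set RB, measurable U ->
    mu (ev f @^-1` U) = if s == 0 then \d_(0 : RB) U else normal_prob 0 s U.
Proof.
have [m [s law]] := gaussian_ev gmu f.
have {}law (U : set RB) : measurable U ->
    mu (ev f @^-1` U) = if s == 0 then \d_(m : RB) U else normal_prob m s U.
  by move=> mU; have := law U mU.
have Ef : (\int[mu]_phi (phi f)%:E = 0)%E.
  by have := centered_ev gmu f; rewrite expectation.unlock.
have Vf := covariance_integral f f.
have mid : measurable_fun setT (EFin \o (idfun : RB -> R)).
  by apply/measurable_EFinP; exact: measurable_id.
have [s0|s0] := eqVneq s 0.
  have lawd (U : set RB) : measurable U -> \d_(m : RB) U = mu (ev f @^-1` U).
    by move=> mU; rewrite (law _ mU) s0 eqxx.
  have idir (g : RB -> R) : measurable_fun setT g -> (\d_(m : RB)).-integrable setT (EFin \o g).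
    move=> mg; apply/integrableP; split; first exact/measurable_EFinP.
    rewrite integral_dirac ?diracT ?mul1e ?ltry//.
    by apply: measurableT_comp => //; exact/measurable_EFinP.
  have [_ ] := integral_image (measurable_ev f) lawd (idir idfun (@measurable_id _ _ _)).
  rewrite integral_dirac// diracT mul1e Ef => -[m0].
  have msq : measurable_fun setT (fun x : RB => (x : R) * x) by exact: measurable_funM.
  have [_ ] := integral_image (measurable_ev f) lawd (idir _ msq).
  rewrite integral_dirac//; last exact/measurable_EFinP.
  rewrite diracT mul1e [X in _ = X -> _]Vf => -[mq].
  exists 0; first by rewrite -mq m0 mulr0 expr0n.
  by move=> U mU; rewrite (law _ mU) s0 eqxx m0.
have lawn (U : set RB) : measurable U -> (normal_prob m s : probability RB R) U = mu (ev f @^-1` U).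
  by move=> mU; rewrite (law _ mU) (negbTE s0).
have [i1 E1] := integral_image (measurable_ev f) lawn (integrable_normal_id m s0).
have [i2 E2] := integral_image (measurable_ev f) lawn (integrable_normal_sqr m s0).
have m0 : m = 0.
  (* Integrability of [phi f] is recovered from that of [phi f - m], so that the integral of the
     difference can be split. *)
  have ic : mu.-integrable setT (fun=> m%:E) by exact: finite_measure_integrable_cst.
  have if_ : mu.-integrable setT (fun phi : S' => (phi f)%:E).
    rewrite (_ : (fun _ => _) = (fun phi : S' => ((phi f) - m)%:E) \+ (fun=> m%:E))%E.
      exact: integrableD.
    by apply/funext => phi /=; rewrite -EFinD subrK.
  move: E1; rewrite normal_mean//.
  under eq_integral do rewrite /ev EFinB.
  rewrite integralB// Ef integral_cst//= probability_setT mule1 sub0e => -[/esym/eqP].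
  by rewrite oppr_eq0 => /eqP.
exists s; last by move=> U mU; rewrite (law _ mU) m0.
apply: EFin_inj; rewrite -(normal_variance m s0) E2 -Vf m0.
by apply: eq_integral => phi _; rewrite subr0 expr2.
Qed.

Lemma gaussian_cos f (theta : R) : (\int[mu]_phi (cos (phi f + theta))%:E =
  (expR (- (inner f (C f) / 2)) * cos theta)%:E)%E.
Proof.
have [s <-] := gaussian_ev_law f; have [->|s0] := eqVneq s 0 => law.
  have lawd (U : set RB) : measurable U -> \d_(0 : RB) U = mu (ev f @^-1` U).
    by move=> mU; rewrite law.
  have ic : (\d_(0 : RB)).-integrable setT
      (EFin \o (fun x : RB => cos (1 * (x : R) + theta))).
    by apply: integrable_bounded1; [exact: measurable_cos_affine|move=> x; exact: cos_max].
  have [_ ] := integral_image (measurable_ev f) lawd ic.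
  under [RHS]eq_integral do rewrite /ev mul1r; move=> <-.
  rewrite integral_dirac//; last by apply/measurable_EFinP; exact: measurable_cos_affine.
  by rewrite diracT mul1e expr0n/= mul0r oppr0 expR0 !mul1r add0r.
have ic : (normal_prob 0 s : probability RB R).-integrable setT
    (EFin \o (fun x : RB => cos (1 * (x : R) + theta))).
  by apply: integrable_bounded1; [exact: measurable_cos_affine|move=> x; exact: cos_max].
have [_ ] := integral_image (nu := normal_prob 0 s : probability RB R)
  (measurable_ev f) (fun U mU => esym (law U mU)) ic.
under [RHS]eq_integral do rewrite /ev mul1r; move=> <-.
by rewrite normal_cos// expr1n mulr1.
Qed.

Lemma covariance_combl (a : R) f g h : inner (a *: f + g) (C h) = a * inner f (C h) + inner g (C h).
Proof. by rewrite innerC inner_linear !(innerC (C h)). Qed.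

(** Linearity through [C] comes from the symmetry of the covariance, which moves [C] to the other
    argument. *)
Lemma covariance_combr (a : R) f g h : inner h (C (a *: f + g)) = a * inner h (C f) + inner h (C g).
Proof. by rewrite covariance_sym covariance_combl !(covariance_sym _ h). Qed.

End gaussian_law.

(** * Disintegration along a direction *)

Section disintegration.
Context {R : realType} {d : nat}.
Local Notation S := (schwartz R d).
Local Notation S' := (tempered R d).
Local Notation RB := (g_sigma_algebraType R.-ocitv.-measurable).

Lemma tempered_translate (phi psi : S') (a : R) (g : S) :
  (phi + a *: psi) g = phi g + a * psi g.
Proof. by []. Qed.

Lemma measurable_tempered d' (T : measurableType d') (Phi : T -> S') :
  (forall g, measurable_fun setT (fun t => Phi t g : RB)) -> measurable_fun setT Phi.
Proof.
move=> mPhi; apply: (measurability (cylinders (R := R) (d := d))) => //.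
move=> _ [_ [g _ [B mB <-]] <-].
exact: (mPhi g measurableT _ mB).
Qed.

Variables (mu : probability S' R) (C : S -> S).
Hypothesis gmu : centered_gaussian mu C.
Variable h : S.
Local Notation v := (inner h (C h)).

(* Changes the coordinate [z.1 h] into [z.2]; see [shift_to_same]. *)
Definition shift_to (z : S' * RB) : S' :=
  z.1 + (((z.2 : R) - z.1 h) / v) *: embed (C h).

Lemma shift_toE z g :
  shift_to z g = z.1 g + ((z.2 : R) - z.1 h) / v * inner g (C h).
Proof. by rewrite tempered_translate /= (innerC (C h) g). Qed.

Lemma measurable_shift_to : measurable_fun setT shift_to.
Proof.
apply: measurable_tempered => g.
under eq_fun do rewrite shift_toE.
have mev f : measurable_fun setT (fun z : S' * RB => z.1 f : RB).
  by apply: (measurableT_comp (measurable_ev f)); exact: measurable_fst.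
apply: measurable_funD; first exact: mev.
do 2 (apply: measurable_funM; last exact: measurable_cst).
by apply: measurable_funB; [exact: measurable_snd|exact: mev].
Qed.

Variable s : R.
Hypotheses (s0 : s != 0) (sv : s ^+ 2 = v).
Local Notation nu := (normal_prob 0 s : probability RB R).

Let v0 : v != 0. Proof. by rewrite -sv expf_neq0. Qed.

Lemma shift_to_same z : shift_to z h = z.2.
Proof. by rewrite shift_toE divfK// addrC subrK. Qed.

(** Both characteristic functions are computed. For fixed [phi] the argument is affine in [x] with
    slope [b / v], so integrating over [x] gives the factor [exp (- b^2 / (2 v))]; the remaining
    variance, that of [phi g'], is [inner g (C g) - b^2 / v]. *)
Lemma disintegration U : measurable U ->
  mu U = (mu \x nu)%E (shift_to @^-1` U).
Proof.
pose T : {mfun (S' * RB)%type >-> S'} := HB.pack shift_to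
  (isMeasurableFun.Build _ _ _ _ _ measurable_shift_to).
pose P : probability S' R := distribution (mu \x nu : probability _ R)%E T.
suff H : forall U, measurable U -> mu U = P U by exact: H.
apply: tempered_probability_unique => g theta.
have mcos (t : R) f : measurable_fun setT (fun phi : S' => (cos (phi f + t))%:E).
  apply/measurable_EFinP.
  rewrite (_ : (fun _ => _) = (fun x : RB => cos (1 * (x : R) + t)) \o ev f).
    by apply: measurableT_comp; [exact: measurable_cos_affine|exact: measurable_ev].
  by apply/funext => phi; rewrite /= mul1r.
pose f (z : S' * RB) := (cos (shift_to z g + theta))%:E.
have i1 : (mu \x nu)%E.-integrable setT f.
  apply: integrable_bounded1; last by move=> z; exact: cos_max.
  have := measurableT_comp (mcos theta g) measurable_shift_to.
  by move=> /measurable_EFinP.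
have -> : (\int[P]_phi (cos (phi g + theta))%:E = \int[mu \x nu]_z f z)%E.
  by rewrite integral_pushforward//; exact: measurable_shift_to.
rewrite -integral12_prod_meas1// (gaussian_cos gmu).
set b := inner g (C h).
(* [phi g'] is the part of [phi g] that is uncorrelated with [phi h]. *)
pose g' := - (b / v) *: h + g.
have inn phi : fubini_F nu f phi =
    ((expR (- (b ^+ 2 / v / 2)))%:E * (cos (phi g' + theta))%:E)%E.
  rewrite /fubini_F /f.
  transitivity (\int[nu]_x (cos (b / v * (x : R) + (phi g' + theta)))%:E)%E.
    apply: eq_integral => x _; congr EFin; congr cos.
    by rewrite shift_toE /= /g' temperedD temperedZ -/b; field.
  rewrite normal_cos// EFinM; congr ((expR _)%:E * _)%E.
  by rewrite sv; field.
under eq_integral do rewrite inn.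
rewrite integralZl//; last first.
  apply: (@integrable_bounded1 _ _ _ mu (fun phi => cos (phi g' + theta))).
    2: by move=> z; exact: cos_max.
  by apply/measurable_EFinP; exact: mcos.
rewrite (gaussian_cos gmu) -EFinM mulrA -expRD; congr (expR _ * _)%:E.
rewrite /g' covariance_combl !(covariance_combr gmu) (covariance_sym gmu h g) -/b.
by field.
Qed.

Lemma integral_disintegration (f : S' -> R) : mu.-integrable setT (EFin \o f) ->
  (mu \x nu)%E.-integrable setT (fun z => (f (shift_to z))%:E) /\
  (\int[mu]_phi (f phi)%:E = \int[mu]_phi \int[nu]_x (f (shift_to (phi, x)))%:E)%E.
Proof.
move=> i_f; have [i E] := integral_image (m := (mu \x nu)%E) measurable_shift_to disintegration i_f.
by split=> //; rewrite E -integral12_prod_meas1.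
Qed.

(** Increasing [x] by [e] translates [shift_to (phi, x)] by [(e / v) *: embed (C h)], whence the
    factor [v^-1]. *)
Lemma is_derive_shift_to (F : S' -> R) phi (x : R) :
  (forall psi, dderivable (C h) F psi) ->
  is_derive x 1 (fun x : R => F (shift_to (phi, x)))
    (v^-1 * dderive (C h) F (shift_to (phi, x))).
Proof.
move=> dF; set psi := shift_to (phi, x).
have cF : diff_quotient (C h) F psi e @[e --> 0^'] --> dderive (C h) F psi by exact: dF.
have cdiv : (e / v) @[e --> 0^'] --> (0 : R)^'.
  move=> B; rewrite /= !near_simpl /nbhs/=.
  move=> [r /= r0 rB]; exists (r * `|v|); first by rewrite /= mulr_gt0// normr_gt0.
  move=> e /=; rewrite sub0r normrN => er e0.
  apply: rB; last by rewrite mulf_neq0// invr_eq0.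
  by rewrite /= sub0r normrN normrM normfV ltr_pdivrMr// normr_gt0.
have cv : (e^-1 *: (F (shift_to (phi, e *: 1 + x)) - F psi) : R^o) @[e --> 0^']
    --> (v^-1 * dderive (C h) F psi : R^o).
  rewrite (_ : (fun _ => _) = (fun e : R => v^-1 * diff_quotient (C h) F psi (e / v))).
    by apply: cvgM; [exact: cvg_cst|exact: (cvg_comp _ _ cdiv cF)].
  apply/funext => e; rewrite /diff_quotient mulrA.
  have -> : shift_to (phi, e *: 1 + x) = psi + (e / v) *: embed (C h).
    rewrite /psi /shift_to -[RHS]addrA -scalerDl; congr (_ + _ *: _).
    by rewrite [e *: _]mulr1 /=; field.
  by rewrite invfM invrK mulrCA mulVf// mulr1.
apply: DeriveDef; first exact: cvgP cv.
exact: cvg_lim cv.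
Qed.

End disintegration.

(** * Gaussian integration by parts *)

Section gaussian_ibp.
Context {R : realType} {d : nat}.
Local Notation S := (schwartz R d).
Local Notation S' := (tempered R d).
Local Notation RB := (g_sigma_algebraType R.-ocitv.-measurable).

(** The left-hand side is the quotient that defines the derivative at 0 of [Y] restricted to a line;
    this gives access to the usual rules of differentiation. *)
Let diff_quotientE (h : S) (Y : S' -> R) phi :
  (fun e : R => e^-1 *: (Y (phi + (e *: 1 + 0) *: embed h) - Y (phi + 0 *: embed h)) : R^o) =
  diff_quotient h Y phi.
Proof. by apply/funext => e; rewrite scale0r !addr0 [e *: 1]mulr1. Qed.

Lemma dderivable_is_derive (h : S) (Y : S' -> R) phi : dderivable h Y phi ->
  is_derive (0 : R) 1 (fun t : R => Y (phi + t *: embed h)) (dderive h Y phi).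
Proof.
move=> dY; have cY : diff_quotient h Y phi e @[e --> 0^'] --> dderive h Y phi by exact: dY.
rewrite -diff_quotientE in cY.
by apply: DeriveDef; [exact: cvgP cY|exact: cvg_lim cY].
Qed.

Lemma is_derive_dderivable (h : S) (Y : S' -> R) phi (l : R) :
  is_derive (0 : R) 1 (fun t : R => Y (phi + t *: embed h)) l ->
  dderivable h Y phi /\ dderive h Y phi = l.
Proof. by move=> [dY <-]; split; rewrite /dderivable /dderive -diff_quotientE. Qed.

Lemma dderive_eval (h g : S) (n : nat) phi :
  dderivable h (fun phi => phi g ^+ n) phi /\
  dderive h (fun phi => phi g ^+ n) phi = n%:R * phi g ^+ n.-1 * inner h g.
Proof.
apply: is_derive_dderivable.
have dg : is_derive (0 : R) 1 (fun t : R => (phi + t *: embed h) g) (inner h g).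
  rewrite (_ : (fun _ => _) = (fun t : R => phi g + t * inner h g))//.
  by apply: is_derive_eq; rewrite /GRing.scale/=; ring.
rewrite (_ : (fun _ => _) = (fun t : R => (phi + t *: embed h) g : R^o) ^+ n); last first.
  by apply/funext => t; rewrite fctE.
by apply: is_derive_eq; rewrite scale0r addr0.
Qed.

Variables (mu : probability S' R) (C : S -> S).
Hypothesis gmu : centered_gaussian mu C.

Section degenerate.
Variable h : S.
Hypothesis v0 : inner h (C h) = 0.

Lemma ae_eq0_of_variance0 : {ae mu, forall phi : S', phi h = 0}.
Proof.
have [s s2 law] := gaussian_ev_law gmu h.
have s0 : s == 0 by rewrite -sqrf_eq0 s2 v0.
have m0 : measurable (~` [set (0 : RB)]) by apply: measurableC; exact: measurable_set1.
exists (ev h @^-1` (~` [set (0 : RB)])); split => //.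
- by rewrite -[X in measurable X]setTI; exact: (measurable_ev h).
- by rewrite law// s0 diracE memNset//; apply.
Qed.

(** The covariance of [phi g] and [phi h] is the integral of a function that vanishes almost
    everywhere. *)
Lemma covariance_eq0 g : inner g (C h) = 0.
Proof.
apply: EFin_inj; rewrite -(covariance_integral gmu).
rewrite (ae_eq_integral (cst 0%E))//; first by rewrite integral0.
- by apply/measurable_EFinP; apply: measurable_funM; exact: measurable_ev.
- by apply: filterS ae_eq0_of_variance0 => phi -> _ /=; rewrite mulr0.
Qed.

(** By [covariance_eq0] the direction [embed (C h)] is the zero distribution, so every difference
    quotient vanishes. *)
Lemma dderive_degenerate (F : S' -> R) phi : dderive (C h) F phi = 0.
Proof.
have k0 : embed (C h) = 0.
  by apply: val_inj; apply/funext => g /=; rewrite innerC covariance_eq0.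
rewrite /dderive (_ : diff_quotient (C h) F phi = cst 0) ?lim_cst//.
by apply/funext => e; rewrite /diff_quotient k0 scaler0 addr0 subrr mulr0.
Qed.

End degenerate.

(** Both sides vanish if [phi h] has variance zero. Otherwise Stein's identity holds on almost every
    line, and its factor [s ^+ 2 = v] cancels the [v^-1] of [is_derive_shift_to]. *)
Lemma gaussian_ibp (F : S' -> R) h :
  (forall phi, dderivable (C h) F phi) ->
  mu.-integrable setT (fun phi => (phi h * F phi)%:E) ->
  mu.-integrable setT (fun phi => (dderive (C h) F phi)%:E) ->
  (\int[mu]_phi (phi h * F phi)%:E = \int[mu]_phi (dderive (C h) F phi)%:E)%E.
Proof.
move=> dF ihF idF; have [s sv _] := gaussian_ev_law gmu h.
have [v0|v0] := eqVneq (inner h (C h)) 0.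
  under [RHS]eq_integral do rewrite dderive_degenerate//.
  apply: ae_eq_integral => //; first exact: measurable_int ihF.
  by apply: filterS (ae_eq0_of_variance0 v0) => phi -> _; rewrite mul0r.
have s0 : s != 0 by rewrite -sqrf_eq0 sv.
have [i1 ->] := integral_disintegration gmu s0 sv ihF.
have [i2 ->] := integral_disintegration gmu s0 sv idF.
apply: ae_eq_integral => //.
- exact: measurable_fubini_F i1.
- exact: measurable_fubini_F i2.
(* By Fubini both integrands are integrable along almost every line, as Stein's identity
   requires. *)
apply: filterS2 (ae_integrable1 i1) (ae_integrable1 i2) => phi j1 j2 _.
have same x : shift_to C h (phi, x) h = x by rewrite (shift_to_same s0 sv).
transitivity (\int[normal_prob 0 s]_x
    (((x : R) - 0) * F (shift_to C h (phi, x)))%:E)%E.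
  by apply: eq_integral => x _; rewrite same subr0.
have j1' : (normal_prob 0 s : probability RB R).-integrable setT
    (fun x : RB => (((x : R) - 0) * F (shift_to C h (phi, x)))%:E).
  by move: j1; apply: eq_integrable => // x _; rewrite same subr0.
have j2' : (normal_prob 0 s : probability RB R).-integrable setT
    (EFin \o (fun x : RB => (inner h (C h))^-1 * dderive (C h) F (shift_to C h (phi, x)))).
  exact: (integrableZl _ _ j2).
rewrite (normal_stein s0 (fun x => is_derive_shift_to s0 sv phi x dF) j1' j2').
under eq_integral do rewrite EFinM.
by rewrite integralZl// muleA -EFinM sv divff// mul1e.
Qed.

End gaussian_ibp.

(** * Gibbs measures *)

Section gibbs_ibp.
Context {R : realType} {d : nat}.
Local Notation S := (schwartz R d).
Local Notation S' := (tempered R d).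
Variables (mu : probability S' R) (C : S -> S).
Hypothesis gmu : centered_gaussian mu C.
Variable A : {mfun S' >-> measurableTypeR R}.
Hypothesis finite_Z : mu.-integrable setT (fun phi => (expR (- (A phi : R)))%:E).

Let mexpA : measurable_fun setT (fun phi : S' => expR (- (A phi : R))).
Proof. by have /measurable_EFinP := measurable_int _ finite_Z. Qed.

Let Z := fine (boltzmann mu A setT).

Let ZE : (boltzmann mu A : {measure set S' -> \bar R}) setT = Z%:E.
Proof. by rewrite /Z fineK//; exact: integrable_fin_num. Qed.

(** If [Z] were zero, the exponential would vanish almost everywhere; as it is positive everywhere,
    the whole space would be negligible. *)
Let Z_gt0 : 0 < Z.
Proof.
rewrite lt0r; apply/andP; split; last first.
  by rewrite -lee_fin -ZE; apply: integral_ge0 => phi _; rewrite lee_fin expR_ge0.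
apply/eqP => Z0; have := ZE; rewrite Z0 /boltzmann => int0.
have [+ _] := ae_eq_integral_abs mu measurableT (measurable_int _ finite_Z).
under eq_integral do rewrite gee0_abs ?lee_fin ?expR_ge0//.
move=> /(_ int0) [N [mN N0 HN]].
have NT : N = setT.
  apply/seteqP; split => // phi _; apply: HN => /= /(_ Logic.I) [] /eqP.
  by rewrite gt_eqF// expR_gt0.
by have := @probability_setT _ _ _ mu; rewrite -NT N0 => /esym/eqP; rewrite onee_eq0.
Qed.

Definition gibbs_density (phi : S') : R := expR (- (A phi : R)) * Z^-1.

Lemma measurable_gibbs_density : measurable_fun setT gibbs_density.
Proof. by apply: measurable_funM. Qed.

Lemma gibbs_density_ge0 phi : 0 <= gibbs_density phi.
Proof. by rewrite mulr_ge0 ?expR_ge0// invr_ge0 ltW. Qed.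

Lemma gibbsE U : measurable U ->
  (gibbs mu A U = \int[mu]_(phi in U) (gibbs_density phi)%:E)%E.
Proof.
move=> mU; transitivity (mnormalize (boltzmann mu A) mu U) => //.
(* [Z] is finite and positive, so the default value of [mnormalize] is not selected. *)
rewrite /mnormalize ZE eqe gt_eqF//= /gibbs_density.
under [RHS]eq_integral do rewrite EFinM.
rewrite integralZr//; exact: integrableS finite_Z.
Qed.

Lemma integrable_gibbs (X : S' -> R) : (gibbs mu A).-integrable setT (EFin \o X) ->
  mu.-integrable setT (fun phi => (X phi * gibbs_density phi)%:E).
Proof.
move=> iX; have mX := measurable_int _ iX.
exact/(@integrable_density _ _ _ mu (gibbs mu A) _ measurable_gibbs_density
  gibbs_density_ge0 gibbsE _ mX).
Qed.

Lemma integral_gibbs (X : S' -> R) : (gibbs mu A).-integrable setT (EFin \o X) ->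
  (\int[gibbs mu A]_phi (X phi)%:E = \int[mu]_phi (X phi * gibbs_density phi)%:E)%E.
Proof.
move=> iX; have mX := measurable_int _ iX.
exact: (@integral_density _ _ _ mu (gibbs mu A) _ measurable_gibbs_density
  gibbs_density_ge0 gibbsE _ mX).
Qed.

(** This is [gaussian_ibp] for the product of [Y] with the density: differentiating the exponential
    produces the term [- Y * dderive (C h) A]. *)
Lemma gibbs_ibp (Y : S' -> R) h :
  (forall phi, dderivable (C h) A phi) ->
  (forall phi, dderivable (C h) Y phi) ->
  (gibbs mu A).-integrable setT (fun phi => (phi h * Y phi)%:E) ->
  (gibbs mu A).-integrable setT
    (fun phi => (dderive (C h) Y phi - Y phi * dderive (C h) A phi)%:E) ->
  (\int[gibbs mu A]_phi (phi h * Y phi)%:E =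
   \int[gibbs mu A]_phi (dderive (C h) Y phi - Y phi * dderive (C h) A phi)%:E)%E.
Proof.
move=> dA dY ihY idY; rewrite !integral_gibbs//.
pose F phi := Y phi * gibbs_density phi.
have dF phi : dderivable (C h) F phi /\ dderive (C h) F phi =
    (dderive (C h) Y phi - Y phi * dderive (C h) A phi) * gibbs_density phi.
  apply: is_derive_dderivable.
  have dAp := dderivable_is_derive (dA phi).
  have dYp := dderivable_is_derive (dY phi).
  rewrite /F /gibbs_density; apply: is_derive_eq.
  by rewrite scale0r addr0 /GRing.scale/=; ring.
have ihF : mu.-integrable setT (fun phi => (phi h * F phi)%:E).
  by have := integrable_gibbs ihY; apply: eq_integrable => // phi _; rewrite -mulrA.
have idF : mu.-integrable setT (fun phi => (dderive (C h) F phi)%:E).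
  by have := integrable_gibbs idY; apply: eq_integrable => // phi _; rewrite (dF phi).2.
transitivity (\int[mu]_phi (phi h * F phi)%:E)%E.
  by apply: eq_integral => phi _; rewrite -mulrA.
rewrite (gaussian_ibp gmu (fun phi => (dF phi).1) ihF idF).
by apply: eq_integral => phi _; rewrite (dF phi).2.
Qed.

End gibbs_ibp.

(** * Dynamic equations for the moments of the Gibbs measure *)

Section moments.
Context {R : realType} {d : nat}.
Local Notation S := (schwartz R d).
Local Notation S' := (tempered R d).
Variables (mu : probability S' R) (C : S -> S).
Hypothesis gmu : centered_gaussian mu C.
Variable A : {mfun S' >-> measurableTypeR R}.
Hypothesis finite_Z : mu.-integrable setT (fun phi => (expR (- (A phi : R)))%:E).
Local Notation muA := (gibbs mu A).

(** Integration by parts in the direction [C h] with [Y = phi f], whose derivative is the constant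
    [inner (C h) f]. *)
Lemma gibbs_moment2 f h : (forall phi, dderivable (C h) A phi) ->
  muA.-integrable setT (fun phi => (phi f * phi h)%:E) ->
  muA.-integrable setT (fun phi => (phi f * dderive (C h) A phi)%:E) ->
  (\int[muA]_phi (phi f * phi h)%:E =
   (inner (C f) h)%:E - \int[muA]_phi (phi f * dderive (C h) A phi)%:E)%E.
Proof.
move=> dA ifh ifA.
have E phi := dderive_eval (C h) f 1 phi.
have ic : muA.-integrable setT (fun=> (inner (C h) f)%:E).
  exact: finite_measure_integrable_cst.
transitivity (\int[muA]_phi (phi h * phi f)%:E)%E.
  by apply: eq_integral => phi _; rewrite mulrC.
have dfE phi : dderive (C h) (fun phi : S' => phi f) phi = inner (C h) f.
  by rewrite (E phi).2 expr0 !mul1r.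
have iB : muA.-integrable setT (fun phi =>
    ((inner (C h) f)%:E - (phi f * dderive (C h) A phi)%:E)%E) by exact: integrableB.
rewrite (gibbs_ibp gmu finite_Z dA (fun phi => (E phi).1)).
- under eq_integral do rewrite dfE EFinB.
  rewrite integralB//; congr (_ - _)%E.
  by rewrite integral_cst//= probability_setT mule1 innerC (covariance_sym gmu) innerC.
- by apply: eq_integrable ifh => // phi _; rewrite mulrC.
- by apply: eq_integrable iB => // phi _; rewrite dfE.
Qed.

(** Integration by parts with [Y = phi f ^+ n.+1]; the moment of order [p] is written with
    [p = n.+2]. *)
Lemma gibbs_momentS f n : (forall phi, dderivable (C f) A phi) ->
  muA.-integrable setT (fun phi => (phi f ^+ n.+2)%:E) ->
  muA.-integrable setT (fun phi => (phi f ^+ n)%:E) ->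
  muA.-integrable setT (fun phi => (phi f ^+ n.+1 * dderive (C f) A phi)%:E) ->
  (\int[muA]_phi (phi f ^+ n.+2)%:E =
   (n.+1%:R * inner f (C f))%:E * \int[muA]_phi (phi f ^+ n)%:E
   - \int[muA]_phi (phi f ^+ n.+1 * dderive (C f) A phi)%:E)%E.
Proof.
move=> dA i2 i0 i1.
have E phi := dderive_eval (C f) f n.+1 phi.
have iZ : muA.-integrable setT
    (fun phi => ((n.+1%:R * inner f (C f))%:E * (phi f ^+ n)%:E)%E) by exact: integrableZl.
have dE phi : dderive (C f) (fun phi : S' => phi f ^+ n.+1) phi =
    n.+1%:R * inner f (C f) * phi f ^+ n.
  by rewrite (E phi).2 innerC mulrAC.
have iB := integrableB measurableT iZ i1.
transitivity (\int[muA]_phi (phi f * phi f ^+ n.+1)%:E)%E.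
  by apply: eq_integral => phi _; rewrite -exprS.
rewrite (gibbs_ibp gmu finite_Z dA (fun phi => (E phi).1)).
- under eq_integral do rewrite dE EFinB EFinM.
  by rewrite integralB// integralZl.
- by apply: eq_integrable i2 => // phi _; rewrite -exprS.
- by apply: eq_integrable iB => // phi _; rewrite dE EFinB EFinM.
Qed.

(** A second integration by parts, with [Y = dderive (C f) A], removes the remaining factor
    [phi f]. *)
Lemma gibbs_schwinger_dyson2 f : (forall phi, dderivable (C f) A phi) ->
  (forall phi, dderivable (C f) (dderive (C f) A) phi) ->
  muA.-integrable setT (fun phi => (phi f * dderive (C f) A phi)%:E) ->
  muA.-integrable setT (fun phi =>
    (dderive (C f) A phi ^+ 2 - dderive (C f) (dderive (C f) A) phi)%:E) ->
  (- (\int[muA]_phi (phi f * dderive (C f) A phi)%:E) =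
   \int[muA]_phi (dderive (C f) A phi ^+ 2 - dderive (C f) (dderive (C f) A) phi)%:E)%E.
Proof.
move=> dA ddA i1 i2.
have i2N := integrableN i2.
have i3 : muA.-integrable setT (fun phi => (dderive (C f) (dderive (C f) A) phi -
    dderive (C f) A phi * dderive (C f) A phi)%:E).
  by apply: eq_integrable i2N => // phi _; rewrite /= opprB expr2.
rewrite (gibbs_ibp gmu finite_Z dA ddA)// -integralN; last exact: integrable_add_def.
by apply: eq_integral => phi _; rewrite -EFinN opprB expr2.
Qed.

End moments.

(** Each equation carries its own differentiability and integrability hypotheses, which make precise
    that the derivatives and expectations in it exist. For [2 <= p] the truncated subtractions are
    exact. *)
Theorem proposition3p3 (R : realType) (d : nat)
  (mu0 : probability (tempered R d) R)
  (gaussian_mu0 : centered_gaussian mu0 resolvent)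
  (A : {mfun tempered R d >-> measurableTypeR R})
  (finite_Z : mu0.-integrable setT (fun phi => (expR (- (A phi : R)))%:E)) :
  let C : schwartz R d -> schwartz R d := resolvent in
  let muA : probability (tempered R d) R := gibbs mu0 A in
  let E_A (X : tempered R d -> R) : \bar R := ('E_muA[X])%E in
  let has_expectation (X : tempered R d -> R) : Prop :=
    muA.-integrable setT (fun phi => (X phi)%:E) in
  forall f h : schwartz R d,
  [/\ (forall phi, dderivable (C f) A phi) ->
      has_expectation (fun phi => phi f ^+ 2) ->
      has_expectation (fun phi => phi f * dderive (C f) A phi) ->
      E_A (fun phi => phi f ^+ 2) =
      ((inner f (C f))%:E
       - E_A (fun phi => (phi f * dderive (C f) A phi)%R))%E,
      (forall phi, dderivable (C h) A phi) ->
      has_expectation (fun phi => phi f * phi h) ->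
      has_expectation (fun phi => phi f * dderive (C h) A phi) ->
      E_A (fun phi => phi f * phi h) =
      ((inner (C f) h)%:E
       - E_A (fun phi => (phi f * dderive (C h) A phi)%R))%E,
      forall p : nat, (2 <= p)%N ->
      (forall phi, dderivable (C f) A phi) ->
      has_expectation (fun phi => phi f ^+ p) ->
      has_expectation (fun phi => phi f ^+ (p - 2)) ->
      has_expectation (fun phi => phi f ^+ (p - 1) * dderive (C f) A phi) ->
      E_A (fun phi => phi f ^+ p) =
      (((p - 1)%:R * inner f (C f))%:E * E_A (fun phi => (phi f ^+ (p - 2))%R)
       - E_A (fun phi => (phi f ^+ (p - 1) * dderive (C f) A phi)%R))%E
    & (forall phi, dderivable (C f) A phi) ->
      (forall phi, dderivable (C f) (dderive (C f) A) phi) ->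
      has_expectation (fun phi => phi f ^+ 2) ->
      has_expectation (fun phi => phi f * dderive (C f) A phi) ->
      has_expectation (fun phi =>
        dderive (C f) A phi ^+ 2 - dderive (C f) (dderive (C f) A) phi) ->
      E_A (fun phi => phi f ^+ 2) =
      ((inner f (C f))%:E
       + E_A (fun phi =>
           (dderive (C f) A phi ^+ 2 - dderive (C f) (dderive (C f) A) phi)%R))%E ].
Proof.
move=> C muA E_A has_expectation f h.
rewrite /E_A /has_expectation expectation.unlock.
have moment2 := gibbs_moment2 gaussian_mu0 finite_Z.
have second f' : (forall phi, dderivable (C f') A phi) ->
    muA.-integrable setT (fun phi => (phi f' ^+ 2)%:E) ->
    muA.-integrable setT (fun phi => (phi f' * dderive (C f') A phi)%:E) ->
    (\int[muA]_phi (phi f' ^+ 2)%:E =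
     (inner f' (C f'))%:E - \int[muA]_phi (phi f' * dderive (C f') A phi)%:E)%E.
  by move=> dA i2 i1; rewrite innerC -moment2.
split.
- exact: second.
- exact: moment2.
- case=> [//|[//|n]] _; rewrite subn2 subn1 /= => dA.
  exact: gibbs_momentS.
- move=> dA ddA i2 i1 idd; rewrite second//.
  by rewrite (gibbs_schwinger_dyson2 gaussian_mu0 finite_Z).
Qed.
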